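(* Let $f:\Gamma\to\Gamma'$ be a homeomorphism between two metric graphs $\Gamma$ and $\Gamma'$, and let $A$ be a nonempty subset of $\Gamma$. Then $\mathcal L_{\Gamma'}(f(A))=f(\mathcal L_\Gamma(A))$. In particular, $A$ is a rank-determining set of $\Gamma$ if and only if $f(A)$ is a rank-determining set of $\Gamma'$.
   Context: A metric graph is the geometric realization of a finite connected loopless multigraph with each edge identified with a closed interval of positive length. Divisors are elements of the free abelian group on its points; rational functions are continuous piecewise linear functions with integral slopes, $(f)=\sum_v\mathrm{ord}_vf\,(v)$ with $\mathrm{ord}_vf$ the sum of outgoing slopes at $v$; $D\sim D'$ iff $D-D'=(f)$; $|D|$ is the set of effective divisors linearly equivalent to $D$. $\mathrm{supp}|D|=\bigcup_{D'\in|D|}\{v:D'(v)\ne0\}$. For a metric graph $\Gamma$ and nonempty $A\subseteq\Gamma$, $\mathcal L_\Gamma(A)$ is the set of $v\in\Gamma$ such that for every divisor $D$ on $\Gamma$, $A\subseteq\mathrm{supp}|D|$ implies $v\in\mathrm{supp}|D|$. Rank: $r(D)=-1$ if $|D|=\emptyset$, otherwise $r(D)\ge s\ge0$ iff $|D-E|\ne\emptyset$ for all effective $E$ of degree $s$; $r_A(D)$ is the same with $E$ supported on $A$; $A$ is rank-determining if $r(D)=r_A(D)$ for all $D$. *)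

(* Defs.v *)
From HB Require Import structures.
From mathcomp Require Import all_boot all_order all_algebra.
From mathcomp Require Import all_classical all_reals all_analysis.
From mathcomp Require Import freeg.
Set Implicit Arguments.
Unset Strict Implicit.
Unset Printing Implicit Defensive.
Import Order.TTheory GRing.Theory Num.Theory.
Import numFieldNormedType.Exports.
Local Open Scope classical_set_scope.
Local Open Scope ring_scope.

Definition homeomorphism (T U : topologicalType) (f : T -> U) : Prop :=
  exists g : U -> T, [/\ cancel f g, cancel g f, continuous f & continuous g].

Definition adjacent (V E : finType) (src tgt : E -> V) : rel V :=
  fun u v => [exists e, ((src e == u) && (tgt e == v)) ||
                        ((src e == v) && (tgt e == u))].

(* The orientation src -> tgt of each edge is an arbitrary choice that only
   fixes a parametrization of the edge by [0, len e]. *)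
Record metric_graph (R : realType) : Type := MetricGraph {
  vert : finType;
  edge : finType;
  src : edge -> vert;
  tgt : edge -> vert;
  len : edge -> R;
  vert_nonempty : (0 < #|vert|)%N;
  graph_connected : forall u v, connect (adjacent src tgt) u v;
  loopless : forall e, src e != tgt e;
  len_gt0 : forall e, 0 < len e }.

(* As a set, the realization is the disjoint union of the vertices and of the
   open edges; its topology is defined below. *)
Definition realization (R : realType) (G : metric_graph R) : Type :=
  (vert G + {e : edge G & {t : R | 0 < t < len e}})%type.
Coercion realization : metric_graph >-> Sortclass.

HB.instance Definition _ (R : realType) (G : metric_graph R) :=
  Choice.copy (realization G)
    (vert G + {e : edge G & {t : R | 0 < t < len e}})%type.

(* The identification of [0, len e] with the closed edge e; only the values at
   t in [0, len e] are meaningful. *)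
Definition chart (R : realType) (G : metric_graph R) (e : edge G) (t : R) : G :=
  match (insub t : option {t : R | 0 < t < len e}) with
  | Some s => inr (existT _ e s)
  | None => inl (if t <= 0 then src e else tgt e)
  end.

Section Topology.
Context (R : realType) (G : metric_graph R).

(* Quotient topology of the disjoint union of the vertices and of the closed
   intervals [0, len e]. *)
Definition realization_open : set_system G := fun U =>
  forall e : edge G, open (chart e @^-1` U : set (subspace `[0, len e])).

Let openT_ : realization_open setT.
Proof. by move=> e; rewrite preimage_setT; exact: openT. Qed.

Let openI_ : setI_closed realization_open.
Proof. by move=> U V oU oV e; rewrite preimage_setI; exact: openI. Qed.

Let open_bigU_ (I : Type) (f : I -> set G) :
  (forall i, realization_open (f i)) -> realization_open (\bigcup_i f i).
Proof.
by move=> of_ e; rewrite preimage_bigcup; apply: bigcup_open => i _; exact: of_.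
Qed.

HB.instance Definition _ :=
  isOpenTopological.Build (realization G) openT_ openI_ open_bigU_.

End Topology.

Section Divisors.
Context (R : realType) (G : metric_graph R).
Implicit Types (F : G -> R) (A : set G) (v : G).

Local Notation divisor := {freeg (realization G) / int}.
Implicit Types D E : divisor.

(* Continuous, and affine with integral slope on each piece of some
   subdivision 0 = t_0 < ... < t_n = len e of every edge. *)
Definition rational_function F : Prop :=
  continuous F /\
  forall e : edge G, exists ts : seq R,
    itv_partition 0 (len e) ts /\
    forall i, (i < size ts)%N -> exists m : int, forall t : R,
      let a := nth 0 (0 :: ts) i in
      a <= t <= nth 0 (0 :: ts) i.+1 ->
      F (chart e t) = F (chart e a) + m%:~R * (t - a).

(* A dart (e, b) is the edge e traversed from src e to tgt e if b = true, and
   from tgt e to src e if b = false; s is the distance from its origin. *)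
Definition dart_chart (d : edge G * bool) (s : R) : G :=
  chart d.1 (if d.2 then s else len d.1 - s).

(* The parameter s in [0, len) at which the dart d passes through v, if any.
   The darts with dart_pos d v <> None are the tangent directions at v. *)
Definition dart_pos (d : edge G * bool) (v : G) : option R :=
  match v with
  | inl x => if (if d.2 then src d.1 else tgt d.1) == x then Some 0 else None
  | inr p => if tag p == d.1 then
               Some (if d.2 then val (tagged p) else len d.1 - val (tagged p))
             else None
  end.

(* The default value 0 of xget is never reached for rational functions. *)
Definition outgoing_slope F (d : edge G * bool) (s : R) : int :=
  xget 0 [set m : int | \forall h \near 0^'+,
            F (dart_chart d (s + h)) = F (dart_chart d s) + m%:~R * h].

Definition ord F v : int :=
  \sum_(d : edge G * bool)
    (if dart_pos d v is Some s then outgoing_slope F d s else 0).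

Definition lin_equiv D D' : Prop :=
  exists F, rational_function F /\ forall v, coeff v (D - D') = ord F v.

Definition effective D : Prop := forall v, 0 <= coeff v D.

Definition linear_system D : set divisor :=
  [set D' | effective D' /\ lin_equiv D' D].

Definition supp_linear_system D : set G :=
  [set v | exists D', linear_system D D' /\ coeff v D' != 0].

Definition Lset A : set G :=
  [set v | forall D, A `<=` supp_linear_system D -> supp_linear_system D v].

Definition supported_on A D : Prop := forall v, coeff v D != 0 -> A v.

Definition rank_on_ge A D (s : nat) : Prop :=
  forall E, effective E -> supported_on A E -> deg E = s%:Z ->
    linear_system (D - E) !=set0.

Definition is_rank_on A D (r : int) : Prop :=
  (linear_system D = set0 /\ r = -1) \/
  [/\ linear_system D !=set0, 0 <= r &
      forall s : nat, s%:Z <= r <-> rank_on_ge A D s].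

(* For nonempty A exactly one r satisfies is_rank_on A D r. *)
Definition rank_on A D : int := xget (-1) (is_rank_on A D).

Definition rank D : int := rank_on setT D.

Definition rank_determining A : Prop := forall D, rank D = rank_on A D.

End Divisors.

(* Main.v *)
(* The set L(A) is described by the topology alone: v is not in L(A) iff some special
   open set contains v and is disjoint from A, where a connected open set U with finite
   boundary is special if every nonempty clopen part of its complement contains a point with two
   directions into U.

   Given D with A in supp|D| and v not in supp|D|, move to the v-reduced divisor D0 in |D|,
   obtained from the largest F with F(v) = 0 and D + (F) effective; F exists because
   effectivity only constrains the values x of F on the vertices, through the conditions
   D(p) + sum_q floor((x_q - x_p) / len) >= 0, which are stable under suprema. Let U be
   the component of v off supp D0. By the maximum principle no member of |D| meets U, and a
   part of the complement of U with at most one direction into U at each point could be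
   fired, so U is special.

   Conversely, for U special, take a height on the complement of U without local minima
   except at points with two directions into U, and put on each point z off U as many chips
   as there are directions into U or downwards, minus one. Where a function with D + (F)
   effective is maximal off U and the height is lowest, D + (F) would be negative, so |D|
   stays off U. To reach a point y off U, reverse the edges of a downward path from y and
   take F = - T, where T is the distance to U for which moving along the orientation is
   free.

   Finally A is rank-determining iff L(A) is everything: the points of an effective divisor
   E can be replaced one at a time by points of A in the condition that |D - E| is nonempty. *)

Require Import Defs.
From mathcomp Require Import all_boot all_order all_algebra.
From mathcomp Require Import all_classical all_reals all_analysis.
From mathcomp Require Import freeg lra zify.
Set Implicit Arguments.
Unset Strict Implicit.
Unset Printing Implicit Defensive.
Import Order.TTheory GRing.Theory Num.Theory.
Import numFieldNormedType.Exports.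
Local Open Scope classical_set_scope.
Local Open Scope ring_scope.

(** * Darts and germs *)

Lemma near0P (R : realType) (P : R -> Prop) :
  (\forall h \near 0^'+, P h) <-> exists2 e, 0 < e & forall h, 0 < h < e -> P h.
Proof.
split=> [/nbhs_ballP[e /= e0 H]|[e e0 H]].
  exists e => // h /andP[h0 he]; apply: H => //.
  by rewrite /ball /= sub0r normrN gtr0_norm.
apply/nbhs_ballP; exists e => // h; rewrite /ball /= sub0r normrN => he h0.
by apply: H; rewrite h0 -[h]gtr0_norm.
Qed.

Lemma lt2_ex (R : realType) (a b : R) : 0 < a -> 0 < b ->
  exists h, 0 < h < a /\ 0 < h < b.
Proof.
move=> a0 b0; exists (Num.min a b / 2).
have m0 : 0 < Num.min a b by rewrite lt_min a0.
have [ma mb] : Num.min a b <= a /\ Num.min a b <= b by rewrite !ge_min !lexx orbT.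
by split; lra.
Qed.

(** Otherwise the supremum of the [t] up to which [P] holds throughout would be below [b]: [P]
    passes to it from the left and then extends beyond it. This plays the role of compactness in the
    continuation arguments along edges. *)
Lemma real_ind (R : realType) (a b : R) (P : R -> Prop) :
  P a ->
  (forall t, a <= t < b -> (forall u, a <= u <= t -> P u) ->
    exists2 e, 0 < e & forall u, t < u < t + e -> P u) ->
  (forall t, a < t <= b -> (forall u, a <= u < t -> P u) -> P t) ->
  forall t, a <= t <= b -> P t.
Proof.
move=> Pa Pr Pl t0 /andP[at0 t0b].
have ab : a <= b := le_trans at0 t0b.
pose S := [set t | a <= t <= b /\ forall u, a <= u <= t -> P u].
have Sa : S a.
  by split=> [|u /andP[au ua]]; rewrite ?lexx // (_ : u = a) //; lra.
have hS : has_sup S by split; [exists a|exists b => x [/andP[]]].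
have aS : a <= sup S by apply: sup_upper_bound.
have Sb : sup S <= b by apply: ge_sup; [exists a|move=> x [/andP[]]].
have lt u : a <= u < sup S -> P u.
  move=> /andP[au us]; have [t [_ Ht] ut] := sup_gt hS.1 us.
  by apply: Ht; rewrite au ltW.
have le u : a <= u <= sup S -> P u.
  move=> /andP[au]; rewrite le_eqVlt => /orP[/eqP us|us]; last exact/lt/andP.
  have [->//|ua] := eqVneq u a.
  apply: Pl; first by rewrite us Sb lt_neqAle -us eq_sym ua au.
  by move=> x; rewrite us; exact: lt.
have [sb|] := ltP (sup S) b; last by move=> bs; apply: le; lra.
have [|e e0 He] := Pr (sup S) _ le; first by rewrite aS.
have bs0 : 0 < b - sup S by lra.
have [e1 [e1e e1b]] := lt2_ex e0 bs0.
suff : S (sup S + e1) by move=> /(sup_upper_bound hS); lra.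
split=> [|u /andP[au ue]]; first by lra.
have [us|us] := leP u (sup S); first by apply: le; rewrite au.
by apply: He; lra.
Qed.

Section Darts.
Context (R : realType) (G : metric_graph R).
Implicit Types (d : edge G * bool) (z : G) (s t h : R) (e : edge G).

Definition org d : vert G := if d.2 then src d.1 else tgt d.1.
Definition rv d : edge G * bool := (d.1, ~~ d.2).
Definition tip d : vert G := org (rv d).

Lemma rvK : involutive rv. Proof. by case=> e b; rewrite /rv /= negbK. Qed.

Lemma org_rv d : org (rv d) = tip d. Proof. by []. Qed.
Lemma tip_rv d : tip (rv d) = org d. Proof. by rewrite /tip rvK. Qed.
Lemma len_rv d : len (rv d).1 = len d.1. Proof. by []. Qed.

Lemma chart0 e : chart e 0 = inl (src e).
Proof. by rewrite /chart insubF ?lexx // ltxx. Qed.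

Lemma chart_len e : chart e (len e) = inl (tgt e).
Proof. by rewrite /chart insubF ?ltxx ?andbF // leNgt len_gt0. Qed.

Lemma chart_val e (t : {t : R | 0 < t < len e}) :
  chart e (val t) = inr (existT _ e t).
Proof. by rewrite /chart valK. Qed.

Lemma chart_in e t (ht : 0 < t < len e) :
  chart e t = inr (existT _ e (exist _ t ht)).
Proof. by rewrite -chart_val. Qed.

Lemma dart_chart0 d : dart_chart d 0 = inl (org d).
Proof. by case: d => e []; rewrite /dart_chart /= ?chart0 // subr0 chart_len. Qed.

Lemma dart_chart_rv d s : dart_chart (rv d) s = dart_chart d (len d.1 - s).
Proof. by case: d => e []; rewrite /dart_chart //= opprB addrC subrK. Qed.

Lemma dart_chart_len d : dart_chart d (len d.1) = inl (tip d).
Proof. by rewrite -[len d.1]subr0 -dart_chart_rv dart_chart0. Qed.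

Lemma dart_chart_true e t : dart_chart (e, true) t = chart e t.
Proof. by []. Qed.

Lemma dart_posP d z s :
  dart_pos d z = Some s -> 0 <= s < len d.1 /\ dart_chart d s = z.
Proof.
case: z => [x|[e' t]] /=.
  case: eqP => //= xE [<-]; rewrite lexx len_gt0 dart_chart0 /org.
  by split=> //; congr inl.
case: eqP => //= ee; case: d ee => e b /= ee; subst e' => -[<-].
case: t => t ht /=; split; first by case: b => /=; lra.
by case: b; rewrite /dart_chart /= ?subKr (chart_in ht).
Qed.

Lemma dart_pos_chart d s : 0 <= s < len d.1 -> dart_pos d (dart_chart d s) = Some s.
Proof.
move=> /andP[s0 sl]; have [->|sn0] := eqVneq s 0.
  by rewrite dart_chart0 /= /org eqxx.
have sp : 0 < s by rewrite lt_neqAle eq_sym sn0.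
case: d sl => e [] /= sl; rewrite /dart_chart /=.
  have h : 0 < s < len e by rewrite sp.
  by rewrite (chart_in h) /= eqxx.
have h : 0 < len e - s < len e by lra.
by rewrite (chart_in h) /= eqxx subKr.
Qed.

Lemma dart_chartP z : (exists x, z = inl x) \/
  exists e, exists2 t, 0 < t < len e & z = chart e t.
Proof.
case: z => [x|[e t]]; [by left; exists x|right].
by exists e, (val t); [exact: (valP t)|rewrite chart_val].
Qed.

Lemma dart_pos_inl d x : dart_pos d (inl x : G) = if org d == x then Some 0 else None.
Proof. by []. Qed.

Lemma dart_pos_in d e t : 0 < t < len e ->
  dart_pos d (chart e t) =
    if e == d.1 then Some (if d.2 then t else len d.1 - t) else None.
Proof. by move=> h; rewrite (chart_in h). Qed.

Lemma chart_inj e t e' t' : 0 < t < len e -> 0 <= t' <= len e' ->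
  chart e t = chart e' t' -> e = e' /\ t = t'.
Proof.
move=> h h' E.
have P : dart_pos (e, true) (chart e' t') = Some t.
  by rewrite -E -dart_chart_true dart_pos_chart //=; lra.
have [t'0|t'n0] := eqVneq t' 0.
  have := dart_posP P; rewrite dart_chart_true t'0 chart0.
  by rewrite (chart_in h) => -[].
have [t'l|t'nl] := eqVneq t' (len e').
  have := dart_posP P; rewrite dart_chart_true t'l chart_len.
  by rewrite (chart_in h) => -[].
move: P; rewrite dart_pos_in; last first.
  by case/andP: h' => a b; rewrite !lt_neqAle a b eq_sym t'n0 t'nl.
by case: eqP => //= <- [].
Qed.

(** A direction at [z] is represented by the unit-speed path leaving [z] along a dart. Properties of
    such paths survive subdivision, whereas the darts themselves change. *)
Definition germs z (Q : (R -> G) -> Prop) :=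
  forall d s, dart_pos d z = Some s -> Q (fun h => dart_chart d (s + h)).

(** Openness is tested on each closed edge, and a neighbourhood in an interval consists of two
    one-sided ones, which the two darts of the edge describe. So openness can be read off along
    directions. *)
Lemma openP (S : set G) : open S <->
  forall z, S z -> germs z (fun g => \forall h \near 0^'+, S (g h)).
Proof.
rewrite (_ : open S = realization_open S) //.
split=> [oS z + d s /dart_posP[/andP[s0 sl] zE]|H e]; first rewrite -zE {z zE} => Sz.
  have /open_subspaceP[V oV VE] := oS d.1.
  have VP t : 0 <= t <= len d.1 -> V t <-> S (chart d.1 t).
    move=> ht; have : (V `&` `[0, len d.1]) t <-> (chart d.1 @^-1` S `&` `[0, len d.1]) t.
      by rewrite VE.
    by rewrite /setI /= in_itv /=; tauto.
  case: d {oS VE} s0 sl Sz VP => e [] /= s0 sl; rewrite /dart_chart /= => Sz VP.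
    have /nbhs_ballP[r /= r0 Hr] : nbhs s V.
      by apply: open_nbhs_nbhs; split=> //; apply/VP => //; lra.
    apply/near0P; exists (Num.min r (len e - s)); first by rewrite lt_min; lra.
    move=> h /andP[h0]; rewrite lt_min => /andP[hr hl].
    apply/VP; first lra.
    by apply: Hr; rewrite /ball /= opprD addrA subrr sub0r normrN gtr0_norm.
  have /nbhs_ballP[r /= r0 Hr] : nbhs (len e - s) V.
    by apply: open_nbhs_nbhs; split=> //; apply/VP => //; lra.
  apply/near0P; exists (Num.min r (len e - s)); first by rewrite lt_min; lra.
  move=> h /andP[h0]; rewrite lt_min => /andP[hr hl].
  apply/VP; first lra.
  by apply: Hr; rewrite /ball /= (_ : _ - _ = h) ?gtr0_norm //; lra.
(* The forward dart gives the right side of [t], the backward dart the left side. At an end of the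
   edge one side is empty and any radius will do, here 1. *)
have Hloc (t : R) : 0 <= t <= len e -> S (chart e t) ->
    exists2 r, 0 < r & forall u, `|t - u| < r -> 0 <= u <= len e -> S (chart e u).
  move=> /andP[t0 tl] St.
  have [r1 r10 H1] : exists2 r, 0 < r & forall u, t < u < t + r -> u <= len e -> S (chart e u).
    have [tlt|tge] := ltP t (len e); last by exists 1 => // u *; lra.
    have P : dart_pos (e, true) (chart e t) = Some t.
      by rewrite -dart_chart_true dart_pos_chart //=; lra.
    have /near0P[r r0 Hr] := H _ St (e, true) t P.
    exists r => // u /andP[tu ur] _.
    by have := Hr (u - t); rewrite /dart_chart /= (addrC t) subrK; apply; lra.
  have [r2 r20 H2] : exists2 r, 0 < r & forall u, t - r < u < t -> 0 <= u -> S (chart e u).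
    have [tlt|tge] := ltP 0 t; last by exists 1 => // u *; lra.
    have P : dart_pos (e, false) (chart e t) = Some (len e - t).
      rewrite (_ : chart e t = dart_chart (e, false) (len e - t)) ?dart_pos_chart //=.
        lra.
      by rewrite /dart_chart /= subKr.
    have /near0P[r r0 Hr] := H _ St (e, false) _ P.
    exists r => // u /andP[tu ur] _.
    have := Hr (t - u); rewrite /dart_chart /= (_ : len e - _ = u); last lra.
    by apply; lra.
  exists (Num.min r1 r2) => /=; first by rewrite lt_min r10.
  move=> u; rewrite lt_min !ltr_norml => /andP[/andP[a1 a2] /andP[a3 a4]] /andP[u0 ul].
  have [ut|ut|<-//] := ltgtP t u.
    by apply: H1 => //; lra.
  by apply: H2 => //; lra.
rewrite /= openE => t St; rewrite /interior /=.
have [|_] := @nbhs_subspaceP _ _ t; last by move=> x ->.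
rewrite /= in_itv /= => /Hloc/(_ St)[r r0 Hr].
apply/nbhs_ballP; exists r => //= u ur.
Qed.

End Darts.

(** * Rational functions *)

Section Slopes.
Context (R : realType) (G : metric_graph R).
Implicit Types (d : edge G * bool) (z : G) (s t h : R) (e : edge G) (F : G -> R).

Definition germ_slope F (m : int) (g : R -> G) : Prop :=
  \forall h \near 0^'+, F (g h) = F (g 0) + m%:~R * h.

Lemma germ_slope_uniq F g m m' : germ_slope F m g -> germ_slope F m' g -> m = m'.
Proof.
move=> /near0P[e e0 H] /near0P[e' e'0 H'].
have [h [h1 h2]] := lt2_ex e0 e'0; have /andP[h0 _] := h1.
have := H h h1; rewrite H' // => /addrI /mulIf E.
by apply/eqP; rewrite -(eqr_int R) E // gt_eqF.
Qed.

(** A local form of [rational_function] without partitions; [affine_rational] and [rational_affine]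
    show that the two are equivalent. *)
Definition locally_affine F := forall z, germs z (fun g => exists m, germ_slope F m g).

Lemma outgoing_slopeE F d s m :
  germ_slope F m (fun h => dart_chart d (s + h)) -> outgoing_slope F d s = m.
Proof.
move=> H; apply: xget_unique.
  by move: H; rewrite /germ_slope addr0.
by move=> m' /= H'; apply: germ_slope_uniq H; rewrite /germ_slope addr0.
Qed.

Lemma germ_slopeP F m d s : germ_slope F m (fun h => dart_chart d (s + h)) <->
  exists2 e, 0 < e & forall u, s <= u < s + e -> F (dart_chart d u) = F (dart_chart d s) + m%:~R * (u - s).
Proof.
split=> [/near0P[e e0 H]|[e e0 H]].
  exists e => // u /andP[]; rewrite le_eqVlt => /orP[/eqP <- _|su ue].
    by rewrite subrr mulr0 addr0.
  have := H (u - s); rewrite (addrC s) subrK addr0; apply; lra.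
apply/near0P; exists e => // h h0e.
by rewrite H ?addr0 ?(addrC s) ?addrK //; lra.
Qed.

Lemma affine_continuous F : locally_affine F -> continuous F.
Proof.
move=> H; apply/continuousP => A oA; apply/openP => z /= FzA d s ps.
have [m] := H z d s ps; rewrite /germ_slope; rewrite addr0.
have [_ ->] := dart_posP ps.
have /nbhs_ballP[r /= r0 Hr] : nbhs (F z) A by apply: open_nbhs_nbhs.
move=> /near0P[e e0 He]; apply/near0P.
have k0 : 0 < `|m%:~R : R| + 1 by rewrite ltr_wpDl.
exists (Num.min e (r / (`|m%:~R : R| + 1))); first by rewrite lt_min e0 divr_gt0.
move=> h /andP[h0]; rewrite lt_min => /andP[he hr].
rewrite He; last lra.
apply: Hr; rewrite /ball /= opprD addrA subrr sub0r normrN normrM (gtr0_norm h0).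
move: hr; rewrite ltr_pdivlMr // mulrDr mulr1 mulrC => hr.
by apply: lt_trans hr; rewrite ltrDl.
Qed.

(** Real induction on the initial part [[0, t]] of an edge that admits a finite partition: right
    germs extend it past [t], and left germs let it reach a limit. *)
Lemma affine_rational F : locally_affine F -> rational_function F.
Proof.
move=> H; split=> [|e]; first exact: affine_continuous.
pose pw t ts := forall i, (i < size ts)%N -> exists m : int, forall t : R,
      let a := nth 0 (0 :: ts) i in
      a <= t <= nth 0 (0 :: ts) i.+1 ->
      F (chart e t) = F (chart e a) + m%:~R * (t - a).
pose P t := exists ts : seq R, itv_partition 0 t ts /\ pw t ts.
have Pext t t' m : P t -> t < t' -> 
    (forall u, t <= u <= t' -> F (chart e u) = F (chart e t) + m%:~R * (u - t)) -> P t'.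
  move=> [ts [its pts]] tt' Hm; exists (rcons ts t'); split.
    by rewrite -cats1; apply: itv_partition_cat its _; exact: itv_partition1.
  move=> i; rewrite size_rcons ltnS leq_eqVlt => /orP[/eqP->|i_lt].
    exists m => u /=; rewrite nth_rcons ltnn eqxx.
    have -> : nth 0 (0 :: rcons ts t') (size ts) = t.
      rewrite -rcons_cons nth_rcons /= ltnSn.
      exact: itv_partition_nth_size.
    exact: Hm.
  have [k Hk] := pts i i_lt; exists k => u /=.
  have := Hk u; rewrite /= nth_rcons i_lt -rcons_cons nth_rcons /=.
  by rewrite ltnS ltnW.
have slr t : 0 <= t < len e -> exists m : int, exists2 r, 0 < r & forall u, t <= u < t + r -> F (chart e u) = F (chart e t) + m%:~R * (u - t).
  move=> ht; have P1 := dart_pos_chart (d := (e, true)) ht.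
  by have [m /germ_slopeP[r r0 Hr]] := H _ _ _ P1; exists m, r.
have sll t : 0 < t <= len e -> exists m : int, exists2 r, 0 < r & forall u, t - r < u <= t -> F (chart e u) = F (chart e t) + m%:~R * (t - u).
  move=> ht; have P1 : dart_pos (e, false) (dart_chart (e, false) (len e - t)) = Some (len e - t).
    by rewrite dart_pos_chart //=; lra.
  have [m /germ_slopeP[r r0 Hr]] := H _ _ _ P1; exists m, r => // u hu.
  have := Hr (len e - u); rewrite /dart_chart /= !subKr => ->; last lra.
  by congr (_ + _ * _); lra.
have P0 : P 0 by exists [::]; split=> //; split.
have : P (len e); last by [].
apply: (@real_ind _ 0 (len e) P) => //; last by rewrite lexx ltW // len_gt0.
  move=> t ht Pt; have [m [r r0 Hr]] := slr t ht.
  exists r => // u /andP[tu ur]; apply: (Pext t u m) => //; first by apply: Pt; lra.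
  by move=> x hx; apply: Hr; lra.
move=> t ht Pt; have [m [r r0 Hr]] := sll t ht.
(* A point before [t] that is on the edge and within reach of the left germ at [t]. The last piece
   runs from [u] to [t], with slope [- m] since [m] is measured backwards. *)
pose u := Num.max 0 (t - r / 2).
have [u0 ur] : 0 <= u /\ t - r / 2 <= u by rewrite /u !le_max !lexx orbT.
have ut : u < t by rewrite /u gt_max; lra.
apply: (Pext u t (- m)) => //; first by apply: Pt; lra.
move=> x hx; rewrite Hr; last lra.
by rewrite (Hr u) ?mulrNz; lra.
Qed.

End Slopes.

Lemma partition_find (R : realType) (a b s : R) (ts : seq R) :
  itv_partition a b ts -> a <= s < b ->
  exists2 i, (i < size ts)%N & nth 0 (a :: ts) i <= s < nth 0 (a :: ts) i.+1.
Proof.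
elim: ts a => [|x ts IH] a ip /andP[as_ sb].
  by have := itv_partition_nil ip; lra.
have [sx|xs] := ltP s x; first by exists 0; rewrite //= as_.
have [|i i_lt Hi] := IH x (itv_partition_cons ip); first by rewrite xs.
by exists i.+1.
Qed.

Lemma partition_findl (R : realType) (a b s : R) (ts : seq R) :
  itv_partition a b ts -> a < s <= b ->
  exists2 i, (i < size ts)%N & nth 0 (a :: ts) i < s <= nth 0 (a :: ts) i.+1.
Proof.
elim: ts a => [|x ts IH] a ip /andP[as_ sb].
  by have := itv_partition_nil ip; lra.
have [sx|xs] := leP s x; first by exists 0; rewrite //= as_.
have [|i i_lt Hi] := IH x (itv_partition_cons ip); first by rewrite xs.
by exists i.+1.
Qed.

Section Rational.
Context (R : realType) (G : metric_graph R).
Implicit Types (d : edge G * bool) (z : G) (s t h : R) (e : edge G) (F : G -> R).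

Lemma rational_affine F : rational_function F -> locally_affine F.
Proof.
move=> [_ HF] z [e b] s /dart_posP[/= hs _].
have [ts [its pts]] := HF e.
case: b.
  have [i i_lt /andP[h1 h2]] := partition_find its hs.
  have [m Hm] := pts i i_lt; exists m; apply/germ_slopeP => /=.
  exists (nth 0 (0 :: ts) i.+1 - s); first by rewrite subr_gt0.
  move=> u /andP[u1 u2]; rewrite /dart_chart /=.
  rewrite Hm /=; last by move: u2; rewrite /= addrC subrK => u2; lra.
  by rewrite (Hm s) /=; lra.
have hs' : 0 < len e - s <= len e by lra.
have [i i_lt /andP[h1 h2]] := partition_findl its hs'.
have [m Hm] := pts i i_lt; exists (- m); apply/germ_slopeP => /=.
exists (len e - s - nth 0 (0 :: ts) i); first by rewrite subr_gt0.
move=> u /andP[u1 u2]; rewrite /dart_chart /=.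
move: h1 h2 u2 => /=; set a := nth 0 (0 :: ts) i; set a' := nth 0 ts i => h1 h2 u2.
have -> := Hm (len e - u); last by rewrite /= -/a -/a'; lra.
have -> := Hm (len e - s); last by rewrite /= -/a -/a'; lra.
by rewrite -/a mulrNz; lra.
Qed.

Lemma outgoing_slopeP F z d s : rational_function F -> dart_pos d z = Some s ->
  germ_slope F (outgoing_slope F d s) (fun h => dart_chart d (s + h)).
Proof.
move=> /rational_affine H /H[m Hm].
by rewrite (outgoing_slopeE Hm).
Qed.

Lemma rational_cst (a : R) : rational_function (fun _ : G => a).
Proof.
apply: affine_rational => z d s _; exists 0; apply/near0P.
by exists 1 => // h; rewrite mul0r addr0.
Qed.

Lemma germ_slopeD F F' g m m' : germ_slope F m g -> germ_slope F' m' g ->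
  germ_slope (fun z => F z + F' z) (m + m') g.
Proof.
move=> H H'; apply: filterS2 H H' => h -> ->.
by rewrite intrD mulrDl; lra.
Qed.

Lemma germ_slopeN F g m : germ_slope F m g -> germ_slope (fun z => - F z) (- m) g.
Proof. by move=> H; apply: filterS H => h ->; rewrite mulrNz; lra. Qed.

Lemma rationalD F F' : rational_function F -> rational_function F' ->
  rational_function (fun z => F z + F' z).
Proof.
move=> /rational_affine H /rational_affine H'; apply: affine_rational => z d s ps.
have [m Hm] := H z d s ps; have [m' Hm'] := H' z d s ps.
by exists (m + m'); apply: germ_slopeD.
Qed.

Lemma rationalN F : rational_function F -> rational_function (fun z => - F z).
Proof.
move=> /rational_affine H; apply: affine_rational => z d s ps.
by have [m Hm] := H z d s ps; exists (- m); apply: germ_slopeN.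
Qed.

Lemma ordD F F' z : rational_function F -> rational_function F' ->
  ord (fun z => F z + F' z) z = ord F z + ord F' z.
Proof.
move=> rF rF'; rewrite /ord -big_split /=; apply: eq_bigr => d _.
case ps : (dart_pos d z) => [s|]; last by rewrite addr0.
by apply/outgoing_slopeE/germ_slopeD; apply: outgoing_slopeP ps.
Qed.

Lemma ordN F z : rational_function F -> ord (fun z => - F z) z = - ord F z.
Proof.
move=> rF; rewrite /ord -sumrN /=; apply: eq_bigr => d _.
case ps : (dart_pos d z) => [s|]; last by rewrite oppr0.
by apply/outgoing_slopeE/germ_slopeN; apply: outgoing_slopeP ps.
Qed.

Lemma ord_cst (a : R) z : ord (fun _ : G => a) z = 0.
Proof.
rewrite /ord big1 // => d _; case: dart_pos => // s; apply: outgoing_slopeE.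
by apply/near0P; exists 1 => // h; rewrite mul0r addr0.
Qed.

Lemma ord_vert F x : ord F (inl x) = \sum_(d | org d == x) outgoing_slope F d 0.
Proof.
rewrite /ord [RHS]big_mkcond /=; apply: eq_bigr => d _.
by rewrite -/(org d); case: eqP.
Qed.

Lemma ord_in F e t : 0 < t < len e ->
  ord F (chart e t) = outgoing_slope F (e, true) t + outgoing_slope F (e, false) (len e - t).
Proof.
move=> ht; rewrite /ord (bigD1 (e, true)) // (bigD1 (e, false)); last by apply/eqP => -[].
rewrite /= big1 ?addr0.
  by rewrite !dart_pos_in //= eqxx.
by move=> [e' b] /andP[/eqP h1 /eqP h2]; rewrite dart_pos_in //=; case: eqP => // ee; case: b h1 h2; rewrite ee.
Qed.

(** Inside a piece of a partition the two outgoing slopes are [m] and [- m], so only vertices and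
    breakpoints remain. *)
Lemma ord_finite F : rational_function F -> finite_set [set z | ord F z != 0].
Proof.
move=> rF; have [_ /choice[ts Hts]] := rF.
apply: (@sub_finite_set _ _ (range (@inl _ _ : vert G -> G) `|`
   \bigcup_(e in [set: edge G]) chart e @` [set` ts e])); last first.
  rewrite finite_setU; split; first exact/finite_image/finite_finset.
  by apply: bigcup_finite => [|e _]; [exact: finite_finset|exact/finite_image/finite_seq].
move=> z /=; have [[x ->]|[e [t ht ->]]] := dart_chartP z; first by left; exists x.
move=> onz; right; exists e => //; exists t => //=; apply: contraNT onz => tts.
have [its pts] := Hts e.
have ht' : 0 < t <= len e by lra.
have [i i_lt /andP[h1 h2]] := partition_findl its ht'.
have h3 : t < nth 0 (0 :: ts e) i.+1.
  by rewrite lt_neqAle h2 andbT; apply: contraNneq tts => ->; exact: mem_nth.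
have [m Hm] := pts i i_lt.
move: h1 h2 h3 Hm => /=; set a := nth 0 (0 :: ts e) i; set a' := nth 0 (ts e) i => h1 h2 h3 Hm.
rewrite ord_in // (@outgoing_slopeE _ _ _ _ _ m) ?(@outgoing_slopeE _ _ _ (e, false) _ (- m)) ?subrr //.
  apply/germ_slopeP; exists (t - a) => [|u hu]; first lra.
  rewrite /dart_chart /= subKr (Hm (len e - u)); last lra.
  by rewrite (Hm t) ?mulrNz; lra.
apply/germ_slopeP; exists (a' - t) => [|u hu]; first lra.
by rewrite /dart_chart /= (Hm u) ?(Hm t); lra.
Qed.

End Rational.

(** * Edge-convex functions *)

Section Convex.
Context (R : realType) (G : metric_graph R).
Implicit Types (d : edge G * bool) (z : G) (s t h u : R) (e : edge G) (F : G -> R).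

Lemma ord_in_dart F d t : 0 < t < len d.1 ->
  ord F (dart_chart d t) = outgoing_slope F d t + outgoing_slope F (rv d) (len d.1 - t).
Proof.
case: d => e [] /= ht; first by rewrite dart_chart_true ord_in.
rewrite /dart_chart /= ord_in; last lra.
by rewrite /rv /= subKr addrC.
Qed.

(** For rational functions this is convexity along edges, [ord] at an inner point being the jump of
    the slope there. *)
Definition edge_convex F := forall e t, 0 < t < len e -> 0 <= ord F (chart e t).

Lemma edge_convex_dart F d t : edge_convex F -> 0 < t < len d.1 -> 0 <= ord F (dart_chart d t).
Proof. by move=> cF ht; case: d ht => e [] /= ht; apply: cF => /=; lra. Qed.

Lemma rational_slope F d s : rational_function F -> 0 <= s < len d.1 ->
  germ_slope F (outgoing_slope F d s) (fun h => dart_chart d (s + h)).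
Proof. by move=> rF /dart_pos_chart; exact: outgoing_slopeP. Qed.

(** A convex function lies above its tangents. The real induction carries the slope bound along with
    the value bound; the former stops before the tip, where [d] has no outgoing slope. *)
Lemma tangent_le F d s : rational_function F -> edge_convex F -> 0 <= s < len d.1 ->
  F (dart_chart d s) + (outgoing_slope F d s)%:~R * (len d.1 - s) <= F (inl (tip d)).
Proof.
move=> rF cF hs; set m := outgoing_slope F d s; rewrite -dart_chart_len.
pose P u := F (dart_chart d s) + m%:~R * (u - s) <= F (dart_chart d u) /\
  (u < len d.1 -> m <= outgoing_slope F d u).
suff : P (len d.1) by case.
apply: (@real_ind _ s (len d.1) P); last by lra.
- by split=> [|_]; rewrite ?subrr ?mulr0 ?addr0.
- move=> t ht /(_ t)[]; first lra.
  move=> Ft /(_ _)/= mt; have mk : m <= outgoing_slope F d t by apply: mt; lra.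
  have /(rational_slope rF)/germ_slopeP[r r0 Hr] : 0 <= t < len d.1 by lra.
  exists (Num.min r (len d.1 - t)); first by rewrite lt_min; lra.
  move=> u /andP[tu]; rewrite -ltrBlDl lt_min => /andP[ur ul].
  have mkR : m%:~R * (u - t) <= (outgoing_slope F d t)%:~R * (u - t).
    by rewrite ler_wpM2r ?ler_int //; lra.
  split; first by rewrite (Hr u); lra.
  move=> _; rewrite (@outgoing_slopeE _ _ F d u (outgoing_slope F d t)) //.
  apply/germ_slopeP; exists (t + r - u) => [|v hv]; first lra.
  by rewrite (Hr v) ?(Hr u); lra.
- move=> t ht Pt; set l := outgoing_slope F (rv d) (len d.1 - t).
  have /(rational_slope rF)/germ_slopeP : 0 <= len d.1 - t < len (rv d).1 by rewrite /=; lra.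
  rewrite -/l; move=> [r r0 Hr].
  have {}Hr u : t - r < u <= t -> F (dart_chart d u) = F (dart_chart d t) + l%:~R * (t - u).
    move=> hu; have := Hr (len d.1 - u); rewrite !dart_chart_rv !subKr => ->; last lra.
    by congr (_ + _ * _); lra.
  pose u := Num.max s (t - r / 2).
  have [su ur] : s <= u /\ t - r / 2 <= u by rewrite /u !le_max !lexx orbT.
  have ut : u < t by rewrite /u gt_max; lra.
  have [|Fu mu] := Pt u; first lra.
  have {}mu : m <= - l.
    rewrite -(@outgoing_slopeE _ _ F d u (- l)) ?mu //; first lra.
    apply/germ_slopeP; exists (t - u) => [|v hv]; first lra.
    by rewrite (Hr v) ?(Hr u) ?mulrNz; lra.
  have mkR : m%:~R * (t - u) <= (- l)%:~R * (t - u).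
    by rewrite ler_wpM2r ?ler_int //; lra.
  split; first by move: Fu mkR; rewrite (Hr u) ?mulrNz; lra.
  (* The slope does not drop at [t], because [ord] is nonnegative there. *)
  move=> tl; apply: le_trans mu _.
  have ht' : 0 < t < len d.1 by lra.
  by have := edge_convex_dart cF ht'; rewrite ord_in_dart // -/l -(subr_ge0 (- l)) opprK.
Qed.

End Convex.

(** * Edge-convex functions with given vertex values *)

Section VertexFunctions.
Context (R : realType) (G : metric_graph R).
Implicit Types (d : edge G * bool) (z : G) (s t h u : R) (e : edge G) (F : G -> R).
Implicit Types x y : vert G -> R.

(** The largest slope with which an edge-convex rational function with vertex values [x] can leave
    [org d]: an integer whose tangent ends no higher than [x (tip d)]. *)
Definition fl x d : int := Num.floor ((x (tip d) - x (org d)) / len d.1).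

Lemma fl_ge x d (m : int) : (m <= fl x d) = (m%:~R * len d.1 <= x (tip d) - x (org d)).
Proof. by rewrite /fl floor_ge_int ler_pdivlMr // len_gt0. Qed.

Lemma fl_le x d : (fl x d)%:~R * len d.1 <= x (tip d) - x (org d).
Proof. by rewrite -fl_ge. Qed.

Lemma fl_rv x d : fl x d + fl x (rv d) <= 0.
Proof.
have := fl_le x d; have := fl_le x (rv d); rewrite len_rv org_rv tip_rv => h1 h2.
have : (fl x d + fl x (rv d))%:~R * len d.1 <= 0 * len d.1 by rewrite intrD; lra.
by rewrite ler_pM2r ?len_gt0 // -[0 in X in X -> _]/(0%:~R) ler_int.
Qed.

Lemma fl_gt x d : x (tip d) - x (org d) < (fl x d + 1)%:~R * len d.1.
Proof. by rewrite ltNge -fl_ge -ltNge ltrDl. Qed.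

Lemma fl_rv_ge x d : - 1 <= fl x d + fl x (rv d).
Proof.
have := fl_gt x d; have := fl_gt x (rv d); rewrite len_rv org_rv tip_rv => h1 h2.
have : 0 * len d.1 < (fl x d + fl x (rv d) + 2)%:~R * len d.1.
  by rewrite mul0r !intrD; rewrite !intrD in h1 h2; lra.
by rewrite ltr_pM2r ?len_gt0 // -[0 in X in X -> _]/(0%:~R) ltr_int; lia.
Qed.

Lemma fl_rv_eq x d : (fl x d)%:~R * len d.1 = x (tip d) - x (org d) ->
  fl x (rv d) = - fl x d.
Proof.
move=> E; apply/eqP; rewrite eq_le; apply/andP; split; first by have := fl_rv x d; lia.
by rewrite fl_ge tip_rv org_rv /= mulrNz; lra.
Qed.

(* The largest edge-convex function with values [x] on the vertices. *)
Definition interp x z : R :=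
  match z with
  | inl p => x p
  | inr (existT e t) =>
      Num.max (x (src e) + (fl x (e, true))%:~R * val t)
              (x (tgt e) + (fl x (e, false))%:~R * (len e - val t))
  end.

Lemma interp_dart x d u : 0 <= u <= len d.1 -> interp x (dart_chart d u) =
  Num.max (x (org d) + (fl x d)%:~R * u) (x (tip d) + (fl x (rv d))%:~R * (len d.1 - u)).
Proof.
move=> /andP[u0 ul]; have [->|un0] := eqVneq u 0.
  rewrite dart_chart0 /= mulr0 addr0 subr0; apply/esym/max_l.
  by have := fl_le x (rv d); rewrite len_rv org_rv tip_rv; lra.
have [->|unl] := eqVneq u (len d.1).
  rewrite dart_chart_len /= subrr mulr0 addr0; apply/esym/max_r.
  by have := fl_le x d; lra.
have hu : 0 < u < len d.1 by rewrite !lt_neqAle u0 ul unl eq_sym un0.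
case: d {u0 ul un0 unl} hu => e [] hu; first by rewrite dart_chart_true (chart_in hu).
have hu' : 0 < len e - u < len e by rewrite /= in hu; lra.
by rewrite /dart_chart /= (chart_in hu') /= maxC subKr.
Qed.

(** The branch that is larger at [s] stays larger for a while; if both agree at [s], the one with
    the larger slope wins at once. *)
Lemma germ_slope_max F d s (r a b : R) (k m : int) : 0 < r ->
  (forall u, s <= u < s + r -> F (dart_chart d u) =
     Num.max (a + k%:~R * (u - s)) (b + m%:~R * (u - s))) ->
  germ_slope F (if a > b then k else if a < b then m else Num.max k m)
     (fun h => dart_chart d (s + h)).
Proof.
move=> r0 H; apply/germ_slopeP.
have Fs : F (dart_chart d s) = Num.max a b by rewrite H ?subrr ?mulr0 ?addr0 //; lra.
have near (c c' : R) (n n' : int) : c < c' -> exists2 r', 0 < r' <= r & forall u, s <= u < s + r' ->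
    c + n%:~R * (u - s) <= c' + n'%:~R * (u - s).
  move=> cc'; have k0 : 0 < `|n%:~R - n'%:~R : R| + 1 by rewrite ltr_wpDl.
  exists (Num.min r ((c' - c) / (`|n%:~R - n'%:~R : R| + 1))).
    by rewrite lt_min r0 ge_min lexx /= andbT divr_gt0 // subr_gt0.
  move=> u /andP[su]; rewrite -ltrBlDl lt_min => /andP[_]; rewrite ltr_pdivlMr // => hu.
  have h1 : (n%:~R - n'%:~R) * (u - s) <= `|n%:~R - n'%:~R : R| * (u - s).
    by rewrite ler_wpM2r ?ler_norm //; lra.
  by lra.
rewrite Fs; case: ltgtP => ab.
- have [r' /andP[r'0 r'r] Hr] := near _ _ m k ab; exists r' => // u hu.
  by rewrite H ?max_l ?Hr //; lra.
- have [r' /andP[r'0 r'r] Hr] := near _ _ k m ab; exists r' => // u hu.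
  by rewrite H ?max_r ?Hr //; lra.
- exists r => // u hu; rewrite H // ab -addr_maxr; congr (_ + _).
  have us : 0 <= u - s by lra.
  by case: (leP k m) => km; [apply: max_r|apply: max_l]; apply: ler_wpM2r => //; rewrite ler_int // ltW.
Qed.

Lemma interp_slope0 x d : germ_slope (interp x) (fl x d) (fun h => dart_chart d (0 + h)).
Proof.
pose b := x (tip d) + (fl x (rv d))%:~R * len d.1.
have := @germ_slope_max (interp x) d 0 (len d.1) (x (org d)) b (fl x d) (- fl x (rv d)).
have := fl_le x (rv d); rewrite len_rv org_rv tip_rv => hle.
move=> /(_ (len_gt0 _)); case: ltgtP => xb H.
- apply: H => u hu; rewrite interp_dart ?subr0; last lra.
  by congr Num.max; rewrite /b mulrNz; lra.
- by rewrite /b in xb; lra.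
(* Equality at the origin means that the mean slope of the edge is an integer, so the two lines
   coincide. *)
- have E : fl x d = - fl x (rv d).
    by rewrite -{1}(rvK d) fl_rv_eq // tip_rv org_rv /=; rewrite /b in xb; lra.
  rewrite -E maxxx in H; apply: H => u hu; rewrite interp_dart ?subr0; last lra.
  by congr Num.max; rewrite /b E mulrNz; lra.
Qed.

Lemma interp_slope x d t : 0 < t < len d.1 ->
  let a := x (org d) + (fl x d)%:~R * t in
  let b := x (tip d) + (fl x (rv d))%:~R * (len d.1 - t) in
  germ_slope (interp x) (if a > b then fl x d else if a < b then - fl x (rv d)
    else Num.max (fl x d) (- fl x (rv d))) (fun h => dart_chart d (t + h)).
Proof.
move=> ht a b; apply: (@germ_slope_max _ _ _ (len d.1 - t)) => [|u hu]; first lra.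
rewrite interp_dart; last lra.
by congr Num.max; rewrite /a /b ?mulrNz; lra.
Qed.

Lemma interp_rational x : rational_function (interp x).
Proof.
apply: affine_rational => z d s /dart_posP[/andP[s0 sl] _].
have [->|sn0] := eqVneq s 0; first by exists (fl x d); exact: interp_slope0.
have hs : 0 < s < len d.1 by rewrite lt_neqAle eq_sym sn0 s0.
by eexists; exact: (interp_slope x hs).
Qed.

Lemma interp_ord_vert x p : ord (interp x) (inl p) = \sum_(d | org d == p) fl x d.
Proof.
by rewrite ord_vert; apply: eq_bigr => d _; apply/outgoing_slopeE/interp_slope0.
Qed.

Lemma interp_convex x : edge_convex (interp x).
Proof.
move=> e t ht; rewrite -dart_chart_true ord_in_dart //.
have ht' : 0 < len e - t < len (rv (e, true)).1 by rewrite /=; lra.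
rewrite (outgoing_slopeE (interp_slope x (d := (e, true)) ht)).
rewrite (outgoing_slopeE (interp_slope x ht')) rvK tip_rv org_rv /= subKr.
set a := x (org _) + _; set b := x (tip _) + _.
move: (fl x _) (fl x _) => k l.
by case: (ltgtP a b) => _; rewrite ?subrr ?addNr //; lia.
Qed.

Lemma slope_le_fl F d : rational_function F -> edge_convex F ->
  outgoing_slope F d 0 <= fl (fun p => F (inl p)) d.
Proof.
move=> rF cF; rewrite fl_ge; have := @tangent_le _ _ F d 0 rF cF.
by rewrite lexx len_gt0 subr0 dart_chart0 => /(_ isT); lra.
Qed.

Lemma ord_le_fl F p : rational_function F -> edge_convex F ->
  ord F (inl p) <= \sum_(d | org d == p) fl (fun p => F (inl p)) d.
Proof. by move=> rF cF; rewrite ord_vert; apply: ler_sum => d _; exact: slope_le_fl. Qed.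

(** If [F] exceeded both lines at an inner point, its tangents there would force the two outgoing
    slopes below [- fl x d] and [- fl x (rv d)]. Being integers, they would add up to at most
    [1 - 2], against convexity. *)
Lemma le_interp F x z : rational_function F -> edge_convex F ->
  (forall p, F (inl p) <= x p) -> F z <= interp x z.
Proof.
move=> rF cF Fx; have [[p ->]|[e [t ht ->]]] := dart_chartP z; first exact: Fx.
rewrite -dart_chart_true interp_dart; last by rewrite /=; lra.
have cFt := edge_convex_dart (d := (e, true)) cF ht.
move: cFt; rewrite ord_in_dart //.
set r := outgoing_slope _ _ _; set l := outgoing_slope _ _ _ => rl.
rewrite leNgt gt_max; apply/negP => /andP[h1 h2].
have ht1 : 0 <= t < len (e, true).1 by rewrite /=; lra.
have ht2 : 0 <= len e - t < len (rv (e, true)).1 by rewrite /=; lra.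
have := tangent_le rF cF ht1; have := tangent_le rF cF ht2.
rewrite -/r -/l dart_chart_rv tip_rv /= !subKr => t1 t2.
have := Fx (org (e, true)); have := Fx (tip (e, true)).
rewrite /= in h1 h2 t1 t2 ht *.
set X0 := x (org _) in h1 *; set X1 := x (tip _) in h2 *.
move=> x1 x0.
have a1 : l < - fl x (e, true).
  rewrite -(ltr_int R) mulrNz -(ltr_pM2r (_ : 0 < t)); lra.
have a2 : r < - fl x (rv (e, true)).
  rewrite -(ltr_int R) mulrNz -(ltr_pM2r (_ : 0 < len e - t)); lra.
have := fl_rv_ge x (e, true); move: (fl x _) (fl x _) a1 a2 rl; clear; lia.
Qed.

End VertexFunctions.

(** * Refinements *)

Section Iso.
Context (R : realType).
Implicit Types (G H K : metric_graph R).

Definition germ_invariant (G : metric_graph R) (T : Type) (Psi : (R -> G) -> T) :=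
  forall g g', g 0 = g' 0 -> (\forall h \near 0^'+, g h = g' h) -> Psi g = Psi g'.

Definition germ_sum (G : metric_graph R) (Psi : (R -> G) -> int) (z : G) : int :=
  \sum_d (if dart_pos d z is Some s then Psi (fun h => dart_chart d (s + h)) else 0).

(* The same length space with more vertices. As germ_sum ranges over the directions at a
   point, ref_germ_sum says that phi matches the directions at z and at phi z. *)
Record refinement (H G : metric_graph R) (phi : H -> G) : Prop := Refinement {
  ref_bij : bijective phi;
  ref_germ_sum : forall Psi, germ_invariant Psi -> forall z,
    germ_sum Psi (phi z) = germ_sum (fun g => Psi (phi \o g)) z;
  ref_chart : forall e, exists e' a, [/\ 0 <= a, a + len e <= len e' &
    forall t, 0 <= t <= len e -> phi (chart e t) = chart e' (a + t)] }.

Lemma refinement_id G : refinement (@id G).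
Proof.
split; [by exists id|by []|move=> e; exists e, 0; split=> //].
  by rewrite add0r.
by move=> t _; rewrite add0r.
Qed.

Lemma refinement_comp K H G (phi : H -> G) (psi : K -> H) :
  refinement phi -> refinement psi -> refinement (phi \o psi).
Proof.
move=> [b1 s1 c1] [b2 s2 c2]; split; first exact: bij_comp.
  move=> Psi Pi z /=; rewrite s1 // s2 // => g g' g0 gg.
  by apply: Pi; rewrite /= ?g0 //; apply: filterS gg => h /= ->.
move=> e; have [e' [a [a0 ae He]]] := c2 e; have [e'' [b [b0 be He']]] := c1 e'.
exists e'', (b + a); split; [lra|lra|move=> t ht /=].
by rewrite He // He' ?addrA //; lra.
Qed.

Definition indic (P : Prop) : int := if `[<P>] then 1 else 0.

Lemma indic_ge0 P : 0 <= indic P. Proof. by rewrite /indic; case: ifP. Qed.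

Lemma indicT (P : Prop) : P -> indic P = 1.
Proof. by move=> p; rewrite /indic asboolT. Qed.

Lemma indicF (P : Prop) : ~ P -> indic P = 0.
Proof. by move=> p; rewrite /indic asboolF. Qed.

Lemma indic_iff (P Q : Prop) : (P <-> Q) -> indic P = indic Q.
Proof. by move=> /propext ->. Qed.

Lemma indic_eq0 P : (indic P = 0) <-> ~ P.
Proof. by split; [rewrite /indic; case: asboolP|exact: indicF]. Qed.

Lemma germ_sum_eq0 G (Psi : (R -> G) -> int) z : (forall g, 0 <= Psi g) ->
  germ_sum Psi z = 0 <-> germs z (fun g => Psi g = 0).
Proof.
move=> P0; split=> [/eqP|H]; last first.
  by apply: big1 => d _; case ps : (dart_pos d z) => [s|] //; exact: H ps.
rewrite psumr_eq0 => [/allP H d s ps|d _]; last by case: dart_pos.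
by have := H d (mem_index_enum _); rewrite ps => /eqP.
Qed.

(** Turns a statement about all directions into the vanishing of a [germ_sum], the form that
    [ref_germ_sum] transports. *)
Lemma germsP G z (Q : (R -> G) -> Prop) :
  germs z Q <-> germ_sum (fun g => indic (~ Q g)) z = 0.
Proof.
rewrite germ_sum_eq0 => [|g]; last exact: indic_ge0.
by split=> H d s /H; rewrite indic_eq0 ?notK.
Qed.

Definition germ_invariantP G (Q : (R -> G) -> Prop) :=
  forall g g', g 0 = g' 0 -> (\forall h \near 0^'+, g h = g' h) -> Q g -> Q g'.

Lemma germ_invariant_indic G (Q : (R -> G) -> Prop) :
  germ_invariantP Q -> germ_invariant (fun g => indic (Q g)).
Proof.
move=> HQ g g' g0 gg; apply: indic_iff; split; first exact: HQ.
by apply: HQ => //; apply: filterS gg.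
Qed.

Lemma germ_invariant_not G (Q : (R -> G) -> Prop) :
  germ_invariantP Q -> germ_invariantP (fun g => ~ Q g).
Proof.
move=> HQ g g' g0 gg nQ Q'; apply: nQ; apply: HQ Q' => //.
by apply: filterS gg.
Qed.

Lemma ref_germs H G (phi : H -> G) z (Q : (R -> G) -> Prop) : refinement phi ->
  germ_invariantP Q -> germs (phi z) Q <-> germs z (fun g => Q (phi \o g)).
Proof.
move=> rphi HQ; rewrite !germsP (ref_germ_sum rphi) //.
exact/germ_invariant_indic/germ_invariant_not.
Qed.

Lemma germ_invariant_near G (S : set G) :
  germ_invariantP (fun g : R -> G => \forall h \near 0^'+, S (g h)).
Proof. by move=> g g' _ gg Sg; apply: filterS2 gg Sg => h ->. Qed.

Lemma germ_invariant_slope G (F : G -> R) m : germ_invariantP (germ_slope F m).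
Proof.
by move=> g g' g0 gg; rewrite /germ_slope g0 => Sg; apply: filterS2 gg Sg => h ->.
Qed.

Lemma ref_open H G (phi : H -> G) (S : set G) : refinement phi ->
  open (phi @^-1` S) <-> open S.
Proof.
move=> rphi; rewrite !openP.
have [psi pK Kp] := ref_bij rphi; split=> O z Sz.
  have -> : z = phi (psi z) by rewrite Kp.
  apply/(ref_germs _ rphi (@germ_invariant_near G S)).
  by apply: O; rewrite /= Kp.
by apply/(ref_germs _ rphi (@germ_invariant_near G S)); exact: O.
Qed.

Lemma ref_homeo H G (phi : H -> G) : refinement phi -> homeomorphism phi.
Proof.
move=> rphi; have [psi pK Kp] := ref_bij rphi; exists psi; split=> //.
  by apply/continuousP => S oS; apply/(ref_open _ rphi).
apply/continuousP => S oS; apply/(ref_open _ rphi).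
by rewrite (_ : _ @^-1` _ = S) //; apply/seteqP; split=> z /=; rewrite pK.
Qed.

Lemma ref_rational H G (phi : H -> G) (F : G -> R) : refinement phi ->
  rational_function (F \o phi) <-> rational_function F.
Proof.
move=> rphi; have [psi pK Kp] := ref_bij rphi.
have HQ : germ_invariantP (fun g : R -> G => exists m, germ_slope F m g).
  by move=> g g' g0 gg [m Hm]; exists m; apply: germ_invariant_slope Hm.
split=> /rational_affine A; apply: affine_rational => z.
  rewrite -(Kp z); apply/(ref_germs _ rphi HQ) => d s ps.
  by have [m Hm] := A _ _ _ ps; exists m.
have /(ref_germs _ rphi HQ) B := A (phi z).
by move=> d s ps; have [m Hm] := B _ _ ps; exists m.
Qed.

Lemma ordE G (F : G -> R) z :
  ord F z = germ_sum (fun g => xget 0 [set m | germ_slope F m g]) z.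
Proof.
rewrite /ord; apply: eq_bigr => d _; case: dart_pos => // s.
by rewrite /germ_slope addr0.
Qed.

Lemma ref_ord H G (phi : H -> G) (F : G -> R) z : refinement phi ->
  ord (F \o phi) z = ord F (phi z).
Proof.
move=> rphi; rewrite !ordE (ref_germ_sum rphi) // => g g' g0 gg.
congr xget; apply/seteqP; split=> m; first exact: germ_invariant_slope.
by apply: germ_invariant_slope => //; apply: filterS gg.
Qed.

Definition valency_in G (S : set G) (z : G) : int :=
  germ_sum (fun g => indic (\forall h \near 0^'+, S (g h))) z.

Lemma ref_valency H G (phi : H -> G) (S : set G) z : refinement phi ->
  valency_in (phi @^-1` S) z = valency_in S (phi z).
Proof.
move=> rphi; rewrite /valency_in (ref_germ_sum rphi) //.
exact/germ_invariant_indic/germ_invariant_near.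
Qed.

End Iso.

(** * Subdivision of one edge at an inner point *)

Section Subdivision.
Context (R : realType) (G : metric_graph R) (e0 : edge G) (t0 : R).
Hypothesis ht0 : 0 < t0 < len e0.

(** Among the vertices [None] is the new point; among the edges it is the second piece of [e0],
    while [Some e0] becomes the first piece. *)
Let sub_edge : finType := option (edge G).
Let sub_vert : finType := option (vert G).
Definition sub_src (e : sub_edge) : sub_vert := omap (@src R G) e.
Definition sub_tgt (e : sub_edge) : sub_vert :=
  if e is Some e then if e == e0 then None else Some (tgt e) else Some (tgt e0).
Definition sub_len (e : sub_edge) : R :=
  if e is Some e then if e == e0 then t0 else len e else len e0 - t0.

Fact sub_vert_nonempty : (0 < #|sub_vert|)%N.
Proof. by rewrite card_option. Qed.

Fact sub_connected u v : connect (Defs.adjacent sub_src sub_tgt) u v.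
Proof.
have sym : connect_sym (Defs.adjacent sub_src sub_tgt).
  apply: sym_connect_sym => {u v} u v; by apply: eq_existsb => e; rewrite orbC.
have adj e : connect (Defs.adjacent sub_src sub_tgt) (sub_src e) (sub_tgt e).
  by apply/connect1/existsP; exists e; rewrite !eqxx.
have adjE e : connect (Defs.adjacent sub_src sub_tgt) (Some (src e)) (Some (tgt e)).
  have [->|ne] := eqVneq e e0.
    apply: (@connect_trans _ _ None); last exact: (adj None).
    by have := adj (Some e0); rewrite /= eqxx.
  by have := adj (Some e); rewrite /= (negbTE ne).
have conn x y : connect (Defs.adjacent sub_src sub_tgt) (Some x) (Some y).
  have /connectP[p hp ->] := graph_connected x y.
  elim: p x hp => [|w p IH] x /=; first by rewrite connect0.
  move=> /andP[/existsP[e he] /IH]; apply: connect_trans.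
  by case/orP: he => /andP[/eqP <- /eqP <-]; rewrite ?adjE // sym adjE.
have conn0 x : connect (Defs.adjacent sub_src sub_tgt) (Some x) None.
  apply: connect_trans (conn x (src e0)) _.
  by have := adj (Some e0); rewrite /= eqxx.
by case: u v => [x|] [y|]; rewrite ?conn ?conn0 // ?connect0 // sym conn0.
Qed.

Fact sub_loopless e : sub_src e != sub_tgt e.
Proof.
case: e => [e|] //; rewrite /sub_tgt; case: (e == e0) => //.
by apply/eqP => -[E]; have := loopless e; rewrite E eqxx.
Qed.

Fact sub_len_gt0 e : 0 < sub_len e.
Proof.
have h0 := ht0; case: e => [e|] /=; last by lra.
by case: (e == e0); rewrite ?len_gt0 //; lra.
Qed.

Definition subdivision : metric_graph R :=
  MetricGraph sub_vert_nonempty sub_connected sub_loopless sub_len_gt0.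

Let orig (e : edge subdivision) : edge G := if e is Some e then e else e0.
Let off (e : edge subdivision) : R := if e is Some _ then 0 else t0.

Definition sub_map (z : subdivision) : G :=
  match z with
  | inl (Some x) => inl x
  | inl None => chart e0 t0
  | inr (existT e t) => chart (orig e) (off e + val t)
  end.

Let off_len e : 0 <= off e /\ off e + len e <= len (orig e).
Proof.
have h0 := ht0; rewrite /= /sub_len.
by case: e => [e|] /=; [have := len_gt0 e; case: eqP => [->|_]|]; lra.
Qed.

Lemma sub_map_chart e t : 0 <= t <= len e -> sub_map (chart e t) = chart (orig e) (off e + t).
Proof.
move=> /andP[t0' tl]; have [->|tn0] := eqVneq t 0.
  rewrite chart0 addr0; case: e {tl} => [e|] //=; by rewrite chart0.
have [->|tnl] := eqVneq t (len e).
  rewrite chart_len /= /sub_tgt; case: e {tl tn0} => [e|] /=; last first.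
    by rewrite addrC subrK chart_len.
  by rewrite add0r; case: eqP => [->//|_]; rewrite chart_len.
have ht : 0 < t < len e by rewrite !lt_neqAle t0' tl tnl eq_sym tn0.
by rewrite (chart_in ht).
Qed.

Let orig_dart (d : edge subdivision * bool) : edge G * bool := (orig d.1, d.2).
(** The parameter at which the new dart starts along the original one; for a backward dart it is
    counted from the target of the original edge. *)
Let doff (d : edge subdivision * bool) : R :=
  if d.2 then off d.1 else len (orig d.1) - off d.1 - len d.1.

Let doff_len d : 0 <= doff d /\ doff d + len d.1 <= len (orig_dart d).1.
Proof. by case: d => e []; have := off_len e; rewrite /doff /=; lra. Qed.

Lemma sub_map_dart d s : 0 <= s <= len d.1 ->
  sub_map (dart_chart d s) = dart_chart (orig_dart d) (doff d + s).
Proof.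
case: d => e [] hs; rewrite /dart_chart /doff /=; rewrite /= in hs.
  exact: sub_map_chart.
by rewrite sub_map_chart /=; [congr chart|]; lra.
Qed.

(** Together with [dart_lift_uniq] this says that the half-open parameter ranges of the new darts
    partition [[0, len d.1)], so that directions correspond one to one. *)
Let dart_lift d s : 0 <= s < len d.1 -> exists d',
  orig_dart d' = d /\ 0 <= s - doff d' < len d'.1.
Proof.
have h0 := ht0; case: d => e b; rewrite /= => hs; have [ee|ee] := eqVneq e e0; last first.
  exists (Some e, b); rewrite /orig_dart /doff /= (negbTE ee); split=> //.
  by case: b; lra.
subst e; case: b.
  have [st|ts] := ltP s t0.
    by exists (Some e0, true); rewrite /orig_dart /doff /= eqxx; split=> //; lra.
  by exists (None, true); rewrite /orig_dart /doff /=; split=> //; lra.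
have [st|ts] := ltP s (len e0 - t0).
  by exists (None, false); rewrite /orig_dart /doff /=; split=> //; lra.
by exists (Some e0, false); rewrite /orig_dart /doff /= eqxx; split=> //; lra.
Qed.

Let dart_lift_uniq d d' s : orig_dart d = orig_dart d' ->
  0 <= s - doff d < len d.1 -> 0 <= s - doff d' < len d'.1 -> d = d'.
Proof.
have h0 := ht0; case: d d' => [e b] [e' b'] [oe <-]; rewrite /doff /=.
case: e e' oe => [e|] [e'|] //= oe.
- by rewrite oe.
- by subst e; rewrite eqxx; case: b => h1 h2; exfalso; lra.
- by subst e'; rewrite eqxx; case: b => h1 h2; exfalso; lra.
Qed.

Let sub_map_in e t : 0 < t < len e -> 0 < off e + t < len (orig e).
Proof. by have := off_len e; lra. Qed.

Lemma sub_map_inj : injective sub_map.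
Proof.
have h0 := ht0; have vin x e t : 0 < t < len e -> sub_map (inl x) <> sub_map (chart e t).
  move=> ht; rewrite sub_map_chart; last lra.
  case: x => [x|] /=; first by rewrite (chart_in (sub_map_in ht)).
  move=> E; have := chart_inj ht0 _ E; have := sub_map_in ht => h [|E1 E2]; first lra.
  by case: e ht E1 E2 {h E} => [e|] /= ht E1 E2; move: ht; rewrite -?E1 ?eqxx /=; lra.
move=> z z'; have [[x ->]|[e [t ht ->]]] := dart_chartP z;
  have [[x' ->]|[e' [t' ht' ->]]] := dart_chartP z'.
- by case: x x' => [x|] [x'|] //=; rewrite ?(chart_in ht0) // => -[->].
- by move=> /vin => /(_ ht').
- by move=> /esym/vin => /(_ ht).
- rewrite !sub_map_chart; [|lra..] => E.
  have := chart_inj (sub_map_in ht) _ E; have := sub_map_in ht' => h [|E1 E2]; first lra.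
  suff ee : e = e' by subst e'; congr chart; lra.
  case: e e' {E h} ht ht' E1 E2 => [e|] [e'|] //= ht ht'; first by move=> ->.
    by move=> E1 E2; exfalso; move: ht; rewrite E1 eqxx; lra.
  by move=> E1 E2; exfalso; move: ht'; rewrite -E1 eqxx; lra.
Qed.

Lemma sub_map_surj z : exists z', sub_map z' = z.
Proof.
have [[x ->]|[e [t ht ->]]] := dart_chartP z; first by exists (inl (Some x)).
have [|d [dE hd]] := @dart_lift (e, true) t; first by rewrite /=; lra.
exists (dart_chart d (t - doff d)); rewrite sub_map_dart ?dE; last lra.
by rewrite addrC subrK.
Qed.

Lemma sub_refinement : refinement sub_map.
Proof.
have /choice[psi psiP] := sub_map_surj.
split; first by exists psi => // z; apply: sub_map_inj; rewrite psiP.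
  move=> Psi HPsi z.
  (* Group the new darts by the original dart that contains them; in each group at most one dart
     passes through [z]. *)
  rewrite /germ_sum [RHS](partition_big orig_dart xpredT) //; apply: eq_bigr => d _.
  have pos d' s : dart_pos d' z = Some s -> dart_pos (orig_dart d') (sub_map z) = Some (doff d' + s).
    move=> /dart_posP[hs <-]; rewrite sub_map_dart ?dart_pos_chart //; last lra.
    by have := doff_len d'; lra.
  case ps : (dart_pos d (sub_map z)) => [s|]; last first.
    apply/esym/big1 => d' /eqP dE; case ps' : (@dart_pos R subdivision d' z) => [s|] //.
    by have := pos _ _ ps'; rewrite dE ps.
  have [hs zE] := dart_posP ps.
  have [d' [dE hd]] := dart_lift hs.
  have zE' : dart_chart d' (s - doff d') = z.
    by apply: sub_map_inj; rewrite sub_map_dart ?dE -?zE ?(addrC (doff _)) ?subrK //; lra.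
  rewrite (bigD1 d') ?dE //= big1 ?addr0.
    rewrite -{1}zE' dart_pos_chart //; apply: HPsi.
      by rewrite /= !addr0 zE zE'.
    apply/near0P; exists (len d'.1 - (s - doff d')) => [|h hh]; first lra.
    rewrite /= sub_map_dart ?dE; last lra.
    by congr dart_chart; lra.
  move=> d'' /andP[/eqP dE'' ne]; case ps' : (@dart_pos R subdivision d'' z) => [s'|] //.
  have := pos _ _ ps'; rewrite dE'' ps => -[sE].
  have [hs' _] := dart_posP ps'.
  by move: ne; rewrite (@dart_lift_uniq d'' d' s) ?eqxx ?dE //; lra.
move=> e; exists (orig e), (off e); have [h1 h2] := off_len e; split=> // t ht.
exact: sub_map_chart.
Qed.

End Subdivision.

(** Subdivide at the points one after the other. This is what allows finitely many points to be
    treated as vertices. *)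
Lemma refinement_at (R : realType) (G : metric_graph R) (P : seq G) :
  exists (H : metric_graph R) (phi : H -> G), refinement phi /\ forall p, p \in P -> exists x, phi (inl x) = p.
Proof.
elim: P => [|p P [H [phi [rphi HP]]]]; first by exists G, id; split=> //; exact: refinement_id.
have [psi pK Kp] := ref_bij rphi.
have [[x px]|[e [t ht px]]] := dart_chartP (psi p).
  exists H, phi; split=> // q; rewrite inE => /orP[/eqP ->|/HP//].
  by exists x; rewrite -px Kp.
exists (subdivision ht), (phi \o sub_map (ht0 := ht)); split.
  exact/refinement_comp/sub_refinement.
move=> q; rewrite inE => /orP[/eqP ->|/HP[x qx]]; last by exists (Some x).
by exists None; rewrite /= -px Kp.
Qed.

(** * Special open sets *)

Section Special.
Implicit Types T : topologicalType.

(* Topological form of: at most one direction at z leads into U, for z outside U. *)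
Definition thin T (U : set T) (z : T) :=
  forall W, nbhs z W -> exists N, [/\ nbhs z N, N `<=` W & connected (N `&` U)].

(* Clopen parts X of the complement of U play the role of its connected components,
   which avoids proving that the components are finitely many. *)
Definition special T (U : set T) :=
  [/\ open U, connected U, exists2 B, finite_set B & closed (U `|` B) &
      forall X, X !=set0 -> X `<=` ~` U -> closed X -> closed (~` U `\` X) ->
        exists2 z, X z & ~ thin U z].

(** Inside [C] the complement of [O1] is the trace of [O2], so [O1] is relatively closed as well as
    open. *)
Lemma connected_sub_open T (C O1 O2 : set T) : connected C -> open O1 -> open O2 ->
  C `<=` O1 `|` O2 -> O1 `&` O2 `&` C = set0 -> C `&` O1 !=set0 -> C `<=` O1.
Proof.
move=> cC o1 o2 C12 C0 C1; apply/setIidPl/cC => //; first by exists O1.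
exists (~` O2); first by rewrite closedC.
apply/seteqP; split=> z [Cz Oz]; split=> //.
  by move=> O2z; have : (O1 `&` O2 `&` C) z by []; rewrite C0.
by have [|] := C12 z Cz.
Qed.

Lemma continuous_connected T T' (f : T -> T') (C : set T) : continuous f ->
  connected C -> connected (f @` C).
Proof. by move=> cf cC; apply: connected_continuous_connected => //; exact: continuous_subspaceT. Qed.

Section Homeo.
Variables (T T' : topologicalType) (f : T -> T') (g : T' -> T).
Hypotheses (fg : cancel f g) (gf : cancel g f) (cf : continuous f) (cg : continuous g).

Lemma thin_homeo (U : set T) z : thin (g @^-1` U) z -> thin U (g z).
Proof.
have imf (S : set T') : g @` S = f @^-1` S.
  by apply/seteqP; split=> x /= => [[y Sy <-]|Sx]; [rewrite gf|exists (f x)].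
move=> th W Wz; have [|N [Nz NW cN]] := th (g @^-1` W); first exact: cg.
exists (f @^-1` N); split; first by apply: cf; rewrite gf.
  by move=> y /= /NW /=; rewrite fg.
have -> : f @^-1` N `&` U = g @` (N `&` g @^-1` U).
  by rewrite imf; apply/seteqP; split=> y /=; rewrite fg.
exact: continuous_connected.
Qed.

(** Every clause of [special] is topological, whereas divisors depend on edge lengths; this is the
    only invariance that the theorem needs. *)
Lemma special_homeo (U : set T) : special U -> special (g @^-1` U).
Proof.
move=> [oU cU [B fB clB] HU].
have img (S : set T) : f @` S = g @^-1` S.
  by apply/seteqP; split=> z /= => [[x Sx <-]|Sz]; [rewrite fg|exists (g z)].
split.
- by move/continuousP : cg; apply.
- by rewrite -img; exact: continuous_connected.
- exists (f @` B); first exact: finite_image.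
  by rewrite img -preimage_setU; move/continuous_closedP : cg; apply.
move=> X [x Xx] XU clX clUX.
have [||||z Xz nz] := HU (f @^-1` X).
- by exists (g x); rewrite /= gf.
- by move=> z /= /XU; rewrite /= fg.
- by move/continuous_closedP : cf; apply.
- move/continuous_closedP : cf => /(_ _ clUX); congr closed.
  by apply/seteqP; split=> z /=; rewrite fg.
by exists (f z) => // /thin_homeo; rewrite fg.
Qed.

End Homeo.

End Special.

(** * Topology of edges and the maximum principle *)

Section DartTopology.
Context (R : realType) (G : metric_graph R).
Implicit Types (d : edge G * bool) (z : G) (s t h u : R) (e : edge G) (F : G -> R).

Lemma chart_connected e (I : set R) : is_interval I -> I `<=` `[0, len e] ->
  connected (chart e @` I).
Proof.
move=> iI sI; apply: connected_continuous_connected.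
  exact/connected_intervalP.
apply: continuous_subspaceW sI _.
by apply/continuousP => A oA; have := oA e.
Qed.

Lemma dart_connected d (I : set R) : is_interval I -> I `<=` `[0, len d.1] ->
  connected (dart_chart d @` I).
Proof.
case: d => e [] iI sI; first exact: chart_connected.
have -> : dart_chart (e, false) @` I = chart e @` [set t | I (len e - t)].
  apply/seteqP; split=> z /= [t It <-]; last by exists (len e - t) => //; rewrite /dart_chart /= subKr.
  by exists (len e - t); rewrite /= ?subKr.
apply: chart_connected => [x y /= Ix Iy c /andP[xc cy]|t /= /sI].
  by apply: iI Iy Ix _ _; lra.
by rewrite /= !in_itv /=; lra.
Qed.

Definition edge_in e : set G := chart e @` `]0, len e[.

Lemma edge_inP d u : 0 < u < len d.1 -> edge_in d.1 (dart_chart d u).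
Proof.
move=> hu; exists (if d.2 then u else len d.1 - u) => //=.
by rewrite in_itv /=; case: d.2; lra.
Qed.

Lemma edge_in_connected e : connected (edge_in e).
Proof.
apply: chart_connected => [|t /=]; last by rewrite !in_itv /=; lra.
exact: interval_is_interval.
Qed.

Lemma dart_pos_dart d d' u s : 0 < u < len d.1 ->
  dart_pos d' (dart_chart d u) = Some s ->
  (d' = d /\ s = u) \/ (d' = rv d /\ s = len d.1 - u).
Proof.
case: d => e b /= hu; rewrite /dart_chart /=.
have hu' : 0 < (if b then u else len e - u) < len e by case: b; lra.
rewrite dart_pos_in //; case: d' => e' b' /=; case: eqP => // <- [<-].
by case: b b' {hu'} => -[]; [left|right|right|left]; split; rewrite ?subKr.
Qed.

Lemma edge_in_open e : open (edge_in e).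
Proof.
apply/openP => z [t /=]; rewrite in_itv /= => ht <- d s.
rewrite -dart_chart_true => /(dart_pos_dart (d := (e, true)) ht) [[-> ->]|[-> ->]].
  apply/near0P; exists (len e - t); first lra.
  by move=> h hh; apply: (edge_inP (d := (e, true))) => /=; lra.
apply/near0P; exists t; first lra.
by move=> h hh; apply: (edge_inP (d := (e, false))) => /=; lra.
Qed.

Lemma edge_in_vert e p : ~ edge_in e (inl p).
Proof. by move=> [t /=]; rewrite in_itv /= => ht; rewrite (chart_in ht). Qed.

Lemma pointE z : (exists p, z = inl p) \/ exists e, edge_in e z.
Proof.
have [[p ->]|[e [t ht ->]]] := dart_chartP z; [by left; exists p|right].
by exists e; exists t; rewrite //= in_itv.
Qed.

Lemma edge_in_inj e e' z : edge_in e z -> edge_in e' z -> e = e'.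
Proof.
move=> [t /=]; rewrite in_itv /= => ht <- [t' /=]; rewrite in_itv /= => ht' E.
by have [|->] := chart_inj ht' _ E; first lra.
Qed.

Lemma slope_le0 F m (g : R -> G) : germ_slope F m g ->
  (\forall h \near 0^'+, F (g h) <= F (g 0)) -> m <= 0.
Proof.
move=> /near0P[a a0 Ha] /near0P[b b0 Hb].
have [h [h1 h2]] := lt2_ex a0 b0.
have := Hb h h2; rewrite Ha // => mh.
have : m%:~R * h <= 0 * h by rewrite mul0r; lra.
by rewrite ler_pM2r ?(ler_int _ _ 0) //; case/andP: h1.
Qed.

Lemma ord_cst_open F (U : set G) a z : open U -> U z -> (forall w, U w -> F w = a) ->
  ord F z = 0.
Proof.
move=> oU Uz FU; rewrite /ord big1 // => d _; case ps : (dart_pos d z) => [s|] //.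
apply: outgoing_slopeE; have := (openP U).1 oU z Uz d s ps.
by apply: filterS => k Uk; rewrite mul0r !addr0 FU // (dart_posP ps).2 FU.
Qed.

(** At a maximum all outgoing slopes are at most 0 and their sum [ord] is at least 0, so all vanish.
    Hence the set where [F] equals [M] is open in [U], and so is its complement by continuity. *)
Lemma max_principle F (U : set G) M z0 : rational_function F -> open U -> connected U ->
  (forall z, U z -> 0 <= ord F z) -> (forall z, U z -> F z <= M) ->
  U z0 -> F z0 = M -> forall z, U z -> F z = M.
Proof.
move=> rF oU cU oF FM Uz0 Fz0.
have cF := affine_continuous (rational_affine rF).
have o2 : open (F @^-1` [set y | y < M]) by move/continuousP : cF; apply; exact: open_lt.
have o1 : open [set z | U z /\ F z = M].
  apply/openP => z /= [Uz Fz] d s ps.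
  have nU := (openP U).1 oU z Uz.
  have term d' s' : dart_pos d' z = Some s' -> outgoing_slope F d' s' <= 0.
    move=> ps'; apply: slope_le0 (outgoing_slopeP rF ps') _.
    rewrite addr0 (dart_posP ps').2 Fz; have := nU _ _ ps'.
    by apply: filterS => h; exact: FM.
  have s0 : outgoing_slope F d s = 0.
    have sum0 : \sum_d' - (if dart_pos d' z is Some s' then outgoing_slope F d' s' else 0) = 0.
      apply/eqP; rewrite eq_le sumrN oppr_le0 oF //= -sumrN sumr_ge0 // => d' _.
      by case ps' : (dart_pos d' z) => [s'|]; rewrite ?oppr0 // oppr_ge0 term.
    move/eqP : sum0; rewrite psumr_eq0 => [/allP/(_ d (mem_index_enum _))|d' _]; last first.
      by case ps' : (dart_pos d' z) => [s'|]; rewrite ?oppr0 // oppr_ge0 term.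
    by rewrite ps /= oppr_eq0 => /eqP.
  have := outgoing_slopeP rF ps; rewrite s0 /germ_slope addr0 (dart_posP ps).2 Fz.
  by apply: filterS2 (nU _ _ ps) => h Uh; rewrite mul0r addr0.
have : U `<=` [set z | U z /\ F z = M].
  apply: connected_sub_open cU o1 o2 _ _ _.
  - by move=> z Uz; have := FM z Uz; rewrite le_eqVlt => /orP[/eqP|]; [left|right].
  - by apply/seteqP; split=> // z [[[_ /= ->]]]; rewrite ltxx.
  - by exists z0.
by move=> H z /H [].
Qed.

End DartTopology.

(** * Open sets whose boundary consists of vertices *)

Section EdgeAdapted.
Context (R : realType) (G : metric_graph R) (U : set G).
Implicit Types (d : edge G * bool) (z : G) (s t h u : R) (e : edge G) (F : G -> R) (p : vert G).

Definition edge_adapted := forall e, edge_in e `<=` U \/ edge_in e `&` U = set0.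

(** An open edge contains no vertex, hence is covered by two disjoint open sets: [U], and the
    complement of its union with [B]. Connectedness leaves one of them. *)
Lemma edge_adapted_boundary (B : set G) : open U -> closed (U `|` B) ->
  (forall z, B z -> exists p, z = inl p) -> edge_adapted.
Proof.
move=> oU cB HB e.
have [[z [ez Uz]]|nz] := pselect (edge_in e `&` U !=set0); last first.
  by right; apply/seteqP; split=> // z ez; apply: nz; exists z.
left; apply: (connected_sub_open (edge_in_connected (e := e)) oU (O2 := ~` (U `|` B))).
- by rewrite openC.
- move=> y ey; have [Uy|nUy] := pselect (U y); [by left|right=> -[//|/HB[p yp]]].
  by apply: (@edge_in_vert _ _ e p); rewrite -yp.
- by apply/seteqP; split=> // y [[Uy +] _]; apply; left.
- by exists z.
Qed.

Definition inner e : bool := `[< edge_in e `<=` U >].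

Hypothesis oU : open U.
Hypothesis aU : edge_adapted.

Lemma innerP e z : inner e -> edge_in e z -> U z.
Proof. by move=> /asboolP; exact. Qed.

Lemma outerP e z : ~~ inner e -> edge_in e z -> ~ U z.
Proof.
move=> /asboolP ne ez Uz; have [//|E] := aU e.
by have : (edge_in e `&` U) z by []; rewrite E.
Qed.

Lemma edge_in_iff e z : edge_in e z -> U z <-> inner e.
Proof.
move=> ez; split=> [Uz|ie]; last exact: innerP ez.
by apply: contrapT => /negP ne; exact: outerP ne ez Uz.
Qed.

Lemma near_dart (S : set G) d : (forall u, 0 < u < len d.1 -> S (dart_chart d u)) ->
  \forall h \near 0^'+, S (dart_chart d (0 + h)).
Proof.
move=> H; apply/near0P; exists (len d.1); first exact: len_gt0.
by move=> h hh; rewrite add0r; exact: H.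
Qed.

Lemma near_dartP d : (\forall h \near 0^'+, U (dart_chart d (0 + h))) <-> inner d.1.
Proof.
split=> [/near0P[e e0 He]|id].
  have [h [h1 h2]] := lt2_ex e0 (len_gt0 d.1).
  by apply/(edge_in_iff (edge_inP h2)); have := He h h1; rewrite add0r.
by apply: near_dart => u hu; apply/(edge_in_iff (edge_inP hu)).
Qed.

Lemma vert_inner d : U (inl (org d)) -> inner d.1.
Proof.
move=> Ud; apply/near_dartP; apply: ((openP U).1 oU _ Ud d 0 _).
by rewrite dart_pos_inl eqxx.
Qed.

Lemma outer_vert d : ~~ inner d.1 -> ~ U (inl (org d)).
Proof. by move=> nd /vert_inner; exact/negP. Qed.

Lemma edge_nbhs_thin e z : edge_in e z -> ~ U z -> thin U z.
Proof.
move=> ez nUz W Wz; exists (W `&` edge_in e); split.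
- by apply: filterI Wz _; apply: open_nbhs_nbhs; split=> //; exact: edge_in_open.
- by move=> y [].
- have -> : W `&` edge_in e `&` U = set0; last exact: connected0.
  apply/seteqP; split=> // y [[_ ey] Uy]; apply: nUz.
  exact/(edge_in_iff ez)/(edge_in_iff ey).
Qed.

(** In a neighbourhood without vertices other than [p], a connected piece of [U] lies inside one
    open edge; near [p] it would have to meet the edges of both [d] and [d']. *)
Lemma not_thin_vert p d d' : ~ U (inl p) -> org d = p -> org d' = p -> inner d.1 -> inner d'.1 ->
  d <> d' -> ~ thin U (inl p).
Proof.
move=> nUp od od' id id' dd th.
(* The two darts of one edge start at different vertices, as there are no loops. *)
have ee : d.1 <> d'.1.
  case: d d' od od' {id id'} dd => e b [e' b'] /= + + + E; rewrite -{}E {e'}.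
  by case: b b' => -[] //=; rewrite /org /= => <- E _; have := loopless e; rewrite E eqxx.
pose W := [set z : G | forall q, z = inl q -> q = p].
have oW : open W.
  apply/openP => z Wz d0 s ps; have [/andP[s0 sl] zE] := dart_posP ps.
  apply/near0P; exists (len d0.1 - s); first by rewrite subr_gt0.
  move=> h hh q E; exfalso.
  have := @edge_inP _ _ d0 (s + h); rewrite E => H; apply: (@edge_in_vert _ _ d0.1 q).
  by apply: H; lra.
have [|N [Np NW cN]] := th W; first by apply: open_nbhs_nbhs; split=> // q [].
have hit d0 : org d0 = p -> inner d0.1 -> (N `&` U `&` edge_in d0.1) !=set0.
  move=> o0 i0; have Np' := Np; move: Np'; rewrite nbhsE => -[V [oV Vp] VN].
  have /near0P[r r0 Hr] : \forall h \near 0^'+, V (dart_chart d0 (0 + h)).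
    by apply: ((openP V).1 oV _ Vp d0 0 _); rewrite dart_pos_inl o0 eqxx.
  have [h [h1 h2]] := lt2_ex r0 (len_gt0 d0.1).
  have e2 := edge_inP h2; exists (dart_chart d0 h); split; [split|] => //.
    by apply: VN; have := Hr h h1; rewrite add0r.
  exact/(edge_in_iff e2).
pose O2 := \bigcup_(e in [set e | e != d.1]) edge_in e.
have : N `&` U `<=` edge_in d.1.
  apply: (connected_sub_open cN (edge_in_open (e := d.1)) (O2 := O2)).
  - by apply: bigcup_open => e _; exact: edge_in_open.
  - move=> z [Nz Uz]; have [[q zq]|[e ez]] := pointE z.
      by exfalso; apply: nUp; rewrite -(NW z Nz q zq) -zq.
    by have [<-|ne] := eqVneq e d.1; [left|right; exists e].
  - by apply/seteqP; split=> // z [[h1 [e /= /eqP ne h2]] _]; apply: ne; exact: edge_in_inj h2 h1.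
  - by have [z [[]]] := hit d od id; exists z.
have [z [NUz ez]] := hit d' od' id'.
by move=> /(_ z NUz) h1; apply: ee; exact: edge_in_inj h1 ez.
Qed.

(** Take a small star at [p] with arms no longer than the edges there: [U] meets it in nothing, or
    in the open arm of the only inner dart. *)
Lemma thin_vert p :
  (forall d d', org d = p -> org d' = p -> inner d.1 -> inner d'.1 -> d = d') ->
  ~ U (inl p) -> thin U (inl p).
Proof.
move=> uniq nUp W; rewrite {1}nbhsE => -[V [oV Vp] VW].
have [r r0 Hr] : exists2 r, 0 < r & forall h, 0 < h < r ->
    forall d, org d = p -> h < len d.1 /\ V (dart_chart d h).
  apply/near0P; apply: filter_forall => d; have [od|nd] := eqVneq (org d) p; last first.
    by apply/near0P; exists 1 => // h _ od; rewrite od eqxx in nd.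
  have /near0P[r r0 Hr] : \forall h \near 0^'+, V (dart_chart d (0 + h)).
    by apply: ((openP V).1 oV _ Vp d 0 _); rewrite dart_pos_inl od eqxx.
  apply/near0P; exists (Num.min r (len d.1)); first by rewrite lt_min r0 len_gt0.
  move=> h /andP[h0]; rewrite lt_min => /andP[hr hl] _; split=> //.
  by have := Hr h; rewrite add0r h0 hr => /(_ isT).
pose N := [set z : G | z = inl p \/ exists d, org d = p /\ exists2 h, 0 < h < r & z = dart_chart d h].
have hl d : org d = p -> r <= len d.1.
  move=> od; rewrite leNgt; apply/negP => lr.
  by have [] := Hr (len d.1) _ d od; rewrite ?len_gt0 // ltxx.
have oN : open N.
  apply/openP => z [->|[d [od [h hh ->]]]] d' s.
    rewrite dart_pos_inl; case: eqP => // od' [<-].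
    by apply/near0P; exists r => // h hh; right; exists d'; split=> //; exists h; rewrite // add0r.
  have hl' := hl d od; have hd : 0 < h < len d.1 by lra.
  move=> /(dart_pos_dart hd) [[-> ->]|[-> ->]]; apply/near0P.
    exists (r - h) => [|k hk]; first lra.
    by right; exists d; split=> //; exists (h + k) => //; lra.
  exists h => [|k hk]; first lra.
  right; exists d; split=> //; exists (h - k); first lra.
  by rewrite dart_chart_rv; congr dart_chart; lra.
exists N; split.
- by apply: open_nbhs_nbhs; split=> //; left.
- move=> z [->|[d [od [h hh ->]]]]; apply: VW => //.
  by have [] := Hr h hh d od.
have ein d h : org d = p -> 0 < h < r -> edge_in d.1 (dart_chart d h).
  by move=> od hh; apply: edge_inP; have := hl d od; lra.
have [[d [od id]]|nd] := pselect (exists d, org d = p /\ inner d.1); last first.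
  have -> : N `&` U = set0; last exact: connected0.
  apply/seteqP; split=> // z [[->//|[d [od [h hh ->]]]]] Uz.
  by apply: nd; exists d; split=> //; exact/(edge_in_iff (ein d h od hh)).
have -> : N `&` U = dart_chart d @` `]0, r[.
  apply/seteqP; split=> z.
    move=> [[->//|[d' [od' [h hh ->]]]]] Uz.
    rewrite (_ : d' = d); first by exists h; rewrite //= in_itv.
    by apply: uniq => //; exact/(edge_in_iff (ein d' h od' hh)).
  move=> [h /=]; rewrite in_itv /= => hh <-; split.
    by right; exists d; split=> //; exists h.
  exact/(edge_in_iff (ein d h od hh)).
apply: dart_connected => [|h /=]; first exact: interval_is_interval.
by rewrite !in_itv /=; have := hl d od; lra.
Qed.

Lemma not_thinP z : ~ U z -> ~ thin U z -> exists d d', 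
  [/\ z = inl (org d), org d' = org d, inner d.1, inner d'.1 & d <> d'].
Proof.
move=> nUz nth; have [[p zp]|[e ez]] := pointE z; last first.
  by case: nth; exact: edge_nbhs_thin ez nUz.
subst z; apply: contrapT => H; apply: nth; apply: thin_vert nUz => d d' od od' id id'.
by apply: contrapT => dd; apply: H; exists d, d'; split=> //; rewrite ?od ?od'.
Qed.

End EdgeAdapted.

(** * Reduced divisors *)

Section VertexBounds.
Context (R : realType) (G : metric_graph R).
Implicit Types (d : edge G * bool) (e : edge G) (p q : vert G) (x : vert G -> R).

Lemma sum_darts (g : edge G * bool -> int) : \sum_d g d = \sum_e (g (e, true) + g (e, false)).
Proof.
transitivity (\sum_e \sum_b g (e, b)); first by rewrite pair_bigA; apply: eq_bigr => -[].
by apply: eq_bigr => e _; rewrite big_bool.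
Qed.

Lemma fl_le0 x d : x (tip d) <= x (org d) -> fl x d <= 0.
Proof.
move=> h; have := fl_le x d => h'.
have : (fl x d)%:~R * len d.1 <= 0 * len d.1 by rewrite mul0r; lra.
by rewrite ler_pM2r ?len_gt0 // (ler_int _ _ 0).
Qed.

Lemma fl_le_int x d (m : int) : x (tip d) - x (org d) < (m + 1)%:~R * len d.1 -> fl x d <= m.
Proof. by move=> h; rewrite leNgt; apply/negP => h'; move: h; rewrite ltNge -fl_ge; lia. Qed.

(** Pair the two darts of each edge. If both start at level [a] or above, use [fl_rv]; if only one
    does, it descends and its [fl] is at most 0. On the edge of [d], which starts at level [a], the
    reverse dart can only lower the sum. *)
Lemma sum_superlevel_le0 x (a : R) :
  \sum_(d | a <= x (org d)) fl x d <= 0 /\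
  forall d, x (org d) = a -> \sum_(d' | a <= x (org d')) fl x d' <= fl x d.
Proof.
pose g d := if a <= x (org d) then fl x d else 0.
have g_le0 d : g d + g (rv d) <= 0.
  rewrite /g org_rv; have := fl_rv x d.
  have h1 := @fl_le0 x d; have h2 := @fl_le0 x (rv d); rewrite tip_rv org_rv in h2.
  case: (leP a (x (org d))) => ha; case: (leP a (x (tip d))) => hb // _; rewrite ?addr0 ?add0r.
    by apply: h1; lra.
  by apply: h2; lra.
rewrite big_mkcond /= -/g sum_darts; split; first by apply: sumr_le0 => e _; exact: g_le0.
move=> d da; rewrite (bigD1 d.1) //= -[leRHS]addr0; apply: lerD.
  have -> : g (d.1, true) + g (d.1, false) = g d + g (rv d).
    by case: d {da} => e [] //=; rewrite addrC.
  have h2 := @fl_le0 x (rv d); rewrite tip_rv org_rv in h2.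
  rewrite /g org_rv da lexx gerDl; case: ifP => // ha.
  by apply: h2; rewrite da.
by apply: sumr_le0 => e _; exact: g_le0.
Qed.

(** The case where [a] is a lower bound of all vertex values at origins. It stands in for the fact
    that principal divisors have degree 0. *)
Lemma sum_fl_le0 x : \sum_p \sum_(d | org d == p) fl x d <= 0.
Proof.
have -> : \sum_p \sum_(d | org d == p) fl x d = \sum_d fl x d.
  by rewrite [RHS](partition_big (@org R G) xpredT).
have [a Ha] : exists a : R, forall d, a <= x (org d).
  have [e0|ne] := pselect (exists d : edge G * bool, True); last first.
    by exists 0 => d; case: ne; exists d.
  case: e0 => d0 _; exists (x (org [arg min_(d < d0) x (org d)]%O)) => d.
  by case: arg_minP => // d' _; apply.
have [+ _] := sum_superlevel_le0 x a.
by rewrite (eq_bigl xpredT) // => d; rewrite Ha.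
Qed.

End VertexBounds.

Section Reduced.
Context (R : realType).

(** The set usually written R(D), for the coefficient function [c] of a divisor; as a mere function,
    [c] can be composed with a refinement. *)
Definition Rset (G : metric_graph R) (c : G -> int) (F : G -> R) :=
  rational_function F /\ forall z, 0 <= c z + ord F z.

(* If c is effective, this says that the divisor c is v-reduced. *)
Definition reduced_at (G : metric_graph R) (c : G -> int) (v : G) :=
  forall F, Rset c F -> forall z, F z <= F v.

Section Vertices.
Context (G : metric_graph R) (c : G -> int).
Hypothesis cV : forall e z, edge_in e z -> c z = 0.
Implicit Types (d : edge G * bool) (e : edge G) (p q : vert G) (x : vert G -> R).

(** With all chips at vertices, membership in [Rset c] becomes a condition on vertex values: those
    of a member satisfy it, and conversely [interp] makes a member out of such values. *)
Definition feasible x := forall p, 0 <= c (inl p) + \sum_(d | org d == p) fl x d.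

Lemma Rset_convex F : Rset c F -> edge_convex F.
Proof.
move=> [_ cF] e t ht; have := cF (chart e t); rewrite (@cV e) ?add0r //.
by exists t; rewrite //= in_itv.
Qed.

Lemma feasible_of_Rset F : Rset c F -> feasible (fun p => F (inl p)).
Proof.
move=> RF p; apply: le_trans (RF.2 (inl p)) _; rewrite lerD2l.
by apply: ord_le_fl; [exact: RF.1|exact: Rset_convex].
Qed.

Lemma Rset_interp x : feasible x -> Rset c (interp x).
Proof.
move=> fx; split=> [|z]; first exact: interp_rational.
have [[p ->]|[e ez]] := pointE z; first by rewrite interp_ord_vert.
rewrite (cV ez) add0r; move: ez => [t /=]; rewrite in_itv /= => ht <-.
exact: interp_convex.
Qed.

(* Sum the conditions of feasibility over the vertices q with x (org d) <= x q. *)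
Lemma fl_lower : exists K : R, forall x d, feasible x -> x (org d) <= x (tip d) + K * len d.1.
Proof.
pose K : int := \sum_q `|c (inl q)|; exists K%:~R => x d fx.
have : - K <= fl x d.
  have [_ /(_ d erefl)] := sum_superlevel_le0 x (x (org d)); apply: le_trans.
  have : 0 <= \sum_(q | x (org d) <= x q) (c (inl q) + \sum_(d' | org d' == q) fl x d').
    by apply: sumr_ge0 => q _; exact: fx.
  rewrite big_split /= => h.
  have -> : \sum_(d' | x (org d) <= x (org d')) fl x d' =
      \sum_(q | x (org d) <= x q) \sum_(d' | org d' == q) fl x d'.
    rewrite (partition_big (@org R G) (fun q => x (org d) <= x q)) //=.
    apply: eq_bigr => q hq; apply: eq_bigl => d'.
    by case: eqP => [->|]; rewrite ?andbF // hq.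
  suff : \sum_(q | x (org d) <= x q) c (inl q) <= K.
    by move=> h'; rewrite lerNl; apply: le_trans h'; rewrite -subr_ge0 opprK.
  rewrite /K [leRHS](bigID (fun q => x (org d) <= x q)) /=.
  apply: le_trans (_ : \sum_(q | x (org d) <= x q) `|c (inl q)| <= _).
    by apply: ler_sum => q _; exact: ler_norm.
  by rewrite lerDl sumr_ge0.
rewrite fl_ge mulrNz; lra.
Qed.

(** Add up the bounds of [fl_lower] along a path from [p] to [p0]. *)
Lemma feasible_bounded p0 p : exists C : R, forall x, feasible x -> x p0 = 0 -> x p <= C.
Proof.
have [K HK] := fl_lower.
have /connectP[s hs ->] := graph_connected p p0.
elim: s p hs => [|w s IH] p /=; first by exists 0 => x _ ->.
move=> /andP[/existsP[e he] /IH[C HC]].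
exists (C + K * len e) => x fx x0.
have xw := HC x fx x0.
case/orP: he => /andP[/eqP h1 /eqP h2].
  by have := HK x (e, true) fx; rewrite /org /= h1 /tip /org /= h2; lra.
by have := HK x (e, false) fx; rewrite /tip /org /= h1 h2; lra.
Qed.

(* The pointwise supremum is feasible since floor is right-continuous. *)
Lemma feasible_max p0 : (exists x, feasible x /\ x p0 = 0) ->
  exists s, [/\ feasible s, s p0 = 0 & forall x, feasible x -> x p0 = 0 -> forall p, x p <= s p].
Proof.
move=> [x1 [fx1 x10]].
pose S p := [set x p | x in [set x | feasible x /\ x p0 = 0]].
have hS p : has_sup (S p).
  split; first by exists (x1 p), x1.
  by have [C HC] := feasible_bounded p0 p; exists C => y [x [fx x0] <-]; exact: HC.
pose s p := sup (S p).
have le_s x : feasible x -> x p0 = 0 -> forall p, x p <= s p.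
  by move=> fx x0 p; apply: sup_upper_bound => //; exists x.
have s0 : s p0 = 0.
  apply/eqP; rewrite eq_le -{2}x10 le_s // andbT.
  by apply: ge_sup; [exact: (hS p0).1|move=> y [x [_ ->] <-]].
exists s; split=> // p.
(* A margin within which increasing the difference along any dart does not reach the next integer
   slope. An [x] within [r / 2] of the supremum at [p] then has [fl x d] at most [fl s d] for the
   darts [d] at [p]. *)
have [r r0 Hr] : exists2 r, 0 < r & forall h, 0 < h < r -> forall d,
    s (tip d) - s (org d) + h < (fl s d + 1)%:~R * len d.1.
  apply/near0P; apply: filter_forall => d; apply/near0P.
  exists ((fl s d + 1)%:~R * len d.1 - (s (tip d) - s (org d))); first by rewrite subr_gt0 fl_gt.
  by move=> h /andP[_]; lra.
have [y [x [fx x0] <-] xp] : exists2 y, S p y & s p - r / 2 < y.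
  by apply: sup_gt; [exact: (hS p).1|rewrite -/(s p); lra].
apply: le_trans (fx p) _; rewrite lerD2l; apply: ler_sum => d /eqP od.
apply: fl_le_int; apply: le_lt_trans (Hr (r / 2) _ d); last lra.
by have := le_s x fx x0 (tip d); rewrite od; lra.
Qed.

End Vertices.

Lemma Rset_ref (H G : metric_graph R) (phi : H -> G) c F : refinement phi ->
  Rset (c \o phi) (F \o phi) <-> Rset c F.
Proof.
move=> rphi; have [psi pK Kp] := ref_bij rphi; split=> -[rF cF]; split.
- exact/(ref_rational _ rphi).
- by move=> z; have := cF (psi z); rewrite /= ref_ord // Kp.
- exact/(ref_rational _ rphi).
- by move=> z; rewrite ref_ord //; exact: cF.
Qed.

Lemma Rset_cst (G : metric_graph R) c F (a : R) : Rset c F -> Rset c (fun z : G => F z + a).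
Proof.
move=> [rF cF]; split=> [|z]; first exact/rationalD/rational_cst.
by rewrite ordD ?ord_cst ?addr0 //; exact: rational_cst.
Qed.

(** Refine so that [v] and the support become vertices. The largest feasible vector vanishing at [v]
    yields by [interp] a function that dominates every member of [Rset c] normalized at [v]. *)
Lemma reduced_exists (G : metric_graph R) (c : G -> int) (v : G) :
  finite_set [set z | c z != 0] -> (exists F, Rset c F) ->
  exists F, Rset c F /\ reduced_at (fun z => c z + ord F z) v.
Proof.
move=> /finite_seqP[s Hs] [F1 RF1].
(* Adding [F] to a member of [Rset] for the new divisor gives a member of [Rset c], so maximality of
   [F] is reducedness. *)
suff [F [RF HF]] : exists F, Rset c F /\ forall F', Rset c F' -> forall z, F' z - F' v <= F z - F v.
  exists F; split=> // F' [rF' cF'] z.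
  suff : Rset c (fun z => F' z + F z) by move=> /HF/(_ z); lra.
  split=> [|y]; first exact: rationalD rF' RF.1.
  by rewrite ordD ?(addrC (ord F' y)) ?addrA //; case: RF.
have [H [phi [rphi HP]]] := refinement_at (v :: s).
have [psi pK Kp] := ref_bij rphi.
have [p0 pv] : exists p0, phi (inl p0) = v by apply: HP; rewrite inE eqxx.
have cV e z : edge_in e z -> (c \o phi) z = 0.
  move=> ez; apply/eqP; apply: contrapT => /negP cz.
  have : [set z | c z != 0] (phi z) by [].
  rewrite Hs /= => zs; have [|q /(can_inj pK) qz] := HP (phi z); first by rewrite inE zs orbT.
  by apply: (@edge_in_vert _ _ e q); rewrite qz.
have [|s0 [fs s00 sM]] := @feasible_max H (c \o phi) p0.
  exists (fun p => F1 (phi (inl p)) + - F1 (phi (inl p0))); split; last by rewrite subrr.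
  by rewrite pv; apply: (feasible_of_Rset cV (F := (fun z => F1 z + - F1 v) \o phi)); apply/(Rset_ref _ _ rphi)/Rset_cst.
have E : interp s0 = (interp s0 \o psi) \o phi by apply/funext => z /=; rewrite pK.
exists (interp s0 \o psi); split.
  by apply/(Rset_ref _ _ rphi); rewrite -E; exact: Rset_interp.
move=> F' RF' z.
have RF'' : Rset (c \o phi) ((fun z => F' z + - F' v) \o phi) by apply/(Rset_ref _ _ rphi)/Rset_cst.
have := @le_interp _ _ _ s0 (psi z) RF''.1 (Rset_convex cV RF'').
rewrite /= Kp -pv pK /= s00 subr0; apply=> p.
have := feasible_of_Rset cV RF'' => /sM /=; rewrite -pv subrr; exact.
Qed.

End Reduced.

(** * The special open set of a reduced divisor *)

Section Firing.
Context (R : realType).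

Lemma germ_avoid_finite (G : metric_graph R) (B : set G) d s : finite_set B ->
  0 <= s < len d.1 -> \forall h \near 0^'+, ~ B (dart_chart d (s + h)).
Proof.
move=> /finite_seqP[b ->] hs; elim: b => [|z b IH]; first by apply: nearW.
suff nz : \forall h \near 0^'+, dart_chart d (s + h) <> z.
  by apply: filterS2 IH nz => h nb nz /=; rewrite inE => /orP[/eqP|].
have [u hu] : exists2 u, 0 < u & forall h, 0 < h < u -> 0 <= s + h < len d.1 /\
    dart_pos d z <> Some (s + h).
  case ps : (dart_pos d z) => [u|]; last first.
    by exists (len d.1 - s) => [|h hh]; [|split=> //]; lra.
  have [us|su] := leP u s; first by exists (len d.1 - s) => [|h hh]; [|split=> [|[]]]; lra.
  exists (Num.min (len d.1 - s) (u - s)); first by rewrite lt_min; lra.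
  by move=> h /andP[h0]; rewrite lt_min => /andP[h1 h2]; split=> [|[]]; lra.
move=> H; apply/near0P; exists u => // h /H [h1 h2] E; apply: h2.
by rewrite -E dart_pos_chart.
Qed.

Section Component.
Context (G : metric_graph R) (B : set G) (v : G).
Hypothesis fB : finite_set B.
Let U := connected_component (~` B) v.

Lemma near_segment z d s : dart_pos d z = Some s -> ~ B z ->
  \forall h \near 0^'+, connected_component (~` B) z (dart_chart d (s + h)).
Proof.
move=> /dart_posP[hs zE] nB; have /near0P[r r0 Hr] := germ_avoid_finite fB hs.
apply/near0P; exists (Num.min r (len d.1 - s)); first by rewrite lt_min; lra.
move=> h /andP[h0]; rewrite lt_min => /andP[hr hl].
apply: (connected_component_max (B := dart_chart d @` `[s, s + h])) => //.
- by exists s => //=; rewrite in_itv /=; lra.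
- move=> y [u /=]; rewrite in_itv /= => /andP[]; rewrite le_eqVlt => /orP[/eqP <- _ <-|su us <-].
    by rewrite zE.
  by have := Hr (u - s); rewrite (addrC s) subrK; apply; lra.
- apply: dart_connected; first exact: interval_is_interval.
  by move=> u /=; rewrite !in_itv /=; lra.
- by exists (s + h) => //=; rewrite in_itv /=; lra.
Qed.

Lemma component_open : open U.
Proof.
apply/openP => z Uz d s ps; have nB : ~ B z := connected_component_sub Uz.
by apply: filterS (near_segment ps nB) => h; exact: connected_component_trans.
Qed.

Lemma component_boundary_closed : closed (U `|` B).
Proof.
rewrite -[X in closed X]setCK closedC.
apply/openP => z /not_orP [nU nB] d s ps; have [hs _] := dart_posP ps.
apply: filterS2 (near_segment ps nB) (germ_avoid_finite fB hs) => h zw nBw [Uw|//].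
by apply: nU; apply: connected_component_trans Uw _; exact: connected_component_sym.
Qed.

End Component.

(** The closed edge is connected and disjoint from [U], so a clopen part of the complement contains
    all of it or none of it. *)
Lemma clopen_edge (G : metric_graph R) (U X : set G) e (a b : R) :
  open U -> edge_adapted U -> ~~ inner U e ->
  X `<=` ~` U -> closed X -> closed (~` U `\` X) ->
  0 <= a <= len e -> 0 <= b <= len e -> X (chart e a) -> X (chart e b).
Proof.
move=> oU aU ne XU cX cY ha hb Xa.
pose C := chart e @` `[0, len e].
have inC t : 0 <= t <= len e -> C (chart e t) by move=> ht; exists t; rewrite //= in_itv.
have CU z : C z -> ~ U z.
  move=> [t /=]; rewrite in_itv /= => ht <-.
  have [->|t0] := eqVneq t 0; first by rewrite chart0; exact: (outer_vert oU aU (d := (e, true))).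
  have [->|tl] := eqVneq t (len e).
    by rewrite chart_len; exact: (outer_vert oU aU (d := (e, false))).
  apply: (outerP aU ne); exists t => //=.
  by rewrite in_itv /= !lt_neqAle eq_sym t0 tl.
have cC : connected C.
  by apply: chart_connected => //; exact: interval_is_interval.
have : C `<=` ~` (~` U `\` X).
  apply: (connected_sub_open cC (O2 := ~` X)).
  - by rewrite openC.
  - by rewrite openC.
  - by move=> z _; have [Xz|nX] := pselect (X z); [left=> -[]|right].
  - apply/seteqP; split=> // z [[h1 h2] h3]; apply: h1; split=> //; exact: CU.
  - by exists (chart e a); split; [exact: inC|move=> []].
move=> /(_ _ (inC b hb)) h; apply: contrapT => nX; apply: h; split=> //.
exact/CU/inC.
Qed.

Lemma clopen_dart (G : metric_graph R) (U X : set G) d :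
  open U -> edge_adapted U -> ~~ inner U d.1 ->
  X `<=` ~` U -> closed X -> closed (~` U `\` X) ->
  X (inl (org d)) -> X (inl (tip d)).
Proof.
move=> oU aU nd XU cX cY; have l0 := len_gt0 d.1.
case: d nd l0 => e [] /= ne l0; rewrite /tip /org /= -chart0 -chart_len;
  by apply: (clopen_edge oU aU ne XU cX cY); lra.
Qed.

Section Fire.
Context (G : metric_graph R) (c : G -> int) (U X : set G) (p0 : vert G).
Hypotheses (c_ge0 : forall z, 0 <= c z) (cV : forall e z, edge_in e z -> c z = 0).
Hypotheses (oU : open U) (cUB : closed (U `|` [set z | c z != 0])) (aU : edge_adapted U).
Hypotheses (Uv : U (inl p0)) (X0 : X !=set0) (XU : X `<=` ~` U).
Hypotheses (cX : closed X) (cY : closed (~` U `\` X)) (thX : forall z, X z -> thin U z).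

(** Fire [X]: the values are 0 at vertices of [X] and [- r] at the others, with [r] at most every
    edge length. Edges outside [U] do not leave [X], and by thinness at most one dart at each vertex
    of [X] enters [U], at the price of one chip. As [p0] is in [U], its value is not the maximum. *)
Lemma fire_not_reduced : ~ reduced_at c (inl p0).
Proof.
have [r r0 Hr] : exists2 r, 0 < r & forall e : edge G, r <= len e.
  have [r r0 Hr] : exists2 r, 0 < r & forall h, 0 < h < r -> forall e : edge G, h <= len e.
    apply/near0P; apply: filter_forall => e; apply/near0P; exists (len e); first exact: len_gt0.
    by move=> h; lra.
  by exists (r / 2) => [|e]; [|apply: Hr]; lra.
pose x p : R := if `[< X (inl p) >] then 0 else - r.
have xX p : X (inl p) -> x p = 0 by move=> Xp; rewrite /x asboolT.
have xN p : ~ X (inl p) -> x p = - r by move=> Xp; rewrite /x asboolF.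
have x_ge p : - r <= x p by rewrite /x; case: ifP; lra.
have feas : feasible c x.
  move=> p; have [Xp|nXp] := pselect (X (inl p)); last first.
    apply: addr_ge0 => //; apply: sumr_ge0 => d /eqP od.
    by rewrite fl_ge mul0r od (xN p) //; have := x_ge (tip d); lra.
  have outer d : org d == p -> ~~ inner U d.1 -> 0 <= fl x d.
    move=> /eqP od nd; rewrite fl_ge mul0r od (xX p) // xX ?subrr //.
    by apply: (clopen_dart oU aU nd XU cX cY); rewrite od.
  have [[d [od id]]|nd] := pselect (exists d, org d = p /\ inner U d.1); last first.
    apply: addr_ge0 => //; apply: sumr_ge0 => d od; apply: outer => //.
    by apply/negP => id; apply: nd; exists d; split=> //; exact/eqP.
  rewrite (bigD1 d) ?od //= addrA; apply: addr_ge0; last first.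
    apply: sumr_ge0 => d' /andP[od' dd']; apply: outer => //; apply/negP => id'.
    have dd : d <> d' by move=> E; rewrite E eqxx in dd'.
    by have := not_thin_vert aU (XU Xp) od (eqP od') id id' dd; apply; exact: thX.
  (* The inner dart makes [p] a limit of points of [U]. Since [p] is not in [U], and [U] together
     with the support is closed, [p] carries a chip. *)
  have c1 : 1 <= c (inl p).
    rewrite -gtz0_ge1 lt_neqAle c_ge0 andbT eq_sym; apply/negP => /negP c0.
    have nUp : ~ U (inl p) by exact: XU.
    have oC : open (~` (U `|` [set z | c z != 0])) by rewrite openC.
    have nC : (~` (U `|` [set z | c z != 0])) (inl p).
      by move=> [Up|/negP n0]; [exact: nUp|exact: c0].
    have H1 := (openP _).1 oC _ nC d 0; rewrite dart_pos_inl od eqxx in H1.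
    have /near0P[a a0 Ha] := H1 erefl.
    have /near0P[b b0 Hb] := (near_dartP aU d).2 id.
    have [h [h1 h2]] := lt2_ex a0 b0.
    by apply: (Ha h h1); left; exact: Hb.
  suff : -1 <= fl x d by lia.
  have h1 := x_ge (tip d); have h2 := Hr d.1; rewrite fl_ge mulrN1z od (xX p) // subr0 mulN1r.
  lra.
move=> red; have [z Xz] := X0.
have [p Xp] : exists p, X (inl p).
  have [[p zp]|[e ez]] := pointE z; first by exists p; rewrite -zp.
  exists (src e); rewrite -chart0.
  have ne : ~~ inner U e by apply/negP => /(innerP)/(_ ez); exact: XU.
  move: ez Xz => [t /=]; rewrite in_itv /= => ht <-.
  by apply: (clopen_edge oU aU ne XU cX cY) => //; have := len_gt0 e; lra.
have := red _ (Rset_interp cV feas) (inl p); rewrite /= xX // xN; first lra.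
by move=> /XU.
Qed.

End Fire.

Lemma special_of_reduced (G : metric_graph R) (c : G -> int) (v : G) :
  (forall z, 0 <= c z) -> finite_set [set z | c z != 0] -> c v = 0 -> reduced_at c v ->
  exists U, [/\ special U, U v & forall F, Rset c F -> forall z, U z -> c z + ord F z = 0].
Proof.
move=> c0 fc cv red; pose B := [set z | c z != 0].
pose U := connected_component (~` B) v.
have oU : open U := @component_open G B v fc.
have cUB : closed (U `|` B) := @component_boundary_closed G B v fc.
have nB : ~ B v by rewrite /B /= cv eqxx.
have Uv : U v by exact: connected_component_refl.
have cU z : U z -> c z = 0.
  by move=> /connected_component_sub; rewrite /B /= => /negP; rewrite negbK => /eqP.
exists U; split=> //; last first.
  move=> F RF z Uz; rewrite cU // add0r.
  (* Reducedness puts the maximum of [F] at [v], and without chips on [U] the maximum principle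
     applies. *)
  have FU : forall z, U z -> F z = F v.
    apply: (max_principle RF.1 oU (component_connected (A := ~` B) (x := v)) _ _ Uv) => //.
      by move=> y Uy; have := RF.2 y; rewrite cU // add0r.
    by move=> y _; exact: red.
  exact: ord_cst_open oU Uz FU.
split=> //.
- exact: component_connected.
- by exists B.
move=> X X0 XU cX cY; apply: contrapT => nth.
have thX z : X z -> thin U z by move=> Xz; apply: contrapT => th; apply: nth; exists z.
have /finite_seqP[s Hs] := fc.
have [H [phi [rphi HP]]] := refinement_at (v :: s).
have [psi [pK Kp cphi cpsi]] := ref_homeo rphi.
have [p0 pv] : exists p0, phi (inl p0) = v by apply: HP; rewrite inE eqxx.
have BV z : c (phi z) != 0 -> exists p, z = inl p.
  move=> cz; have : [set z | c z != 0] (phi z) by [].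
  rewrite Hs /= => zs; have [|q /(can_inj pK) qz] := HP (phi z); first by rewrite inE zs orbT.
  by exists q.
have cV e z : edge_in e z -> (c \o phi) z = 0.
  move=> ez; apply/eqP; apply: contrapT => /negP /BV [p zp].
  by apply: (@edge_in_vert _ _ e p); rewrite -zp.
have cpre (S : set G) : closed S -> closed (phi @^-1` S).
  by move/continuous_closedP : cphi => h; exact: h.
apply: (@fire_not_reduced H (c \o phi) (phi @^-1` U) (phi @^-1` X) p0) => //=.
- by move/continuousP : cphi; apply.
- exact: (cpre (U `|` B)).
- apply: (@edge_adapted_boundary _ _ _ (phi @^-1` B)).
  + by move/continuousP : cphi; apply.
  + exact: (cpre (U `|` B)).
  + exact: BV.
- by rewrite pv.
- by have [x Xx] := X0; exists (psi x); rewrite /= Kp.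
- by move=> z; exact: XU.
- exact: cpre.
- exact: (cpre (~` U `\` X)).
- move=> z Xz; rewrite -(pK z); apply: (thin_homeo pK Kp cphi cpsi).
  rewrite (_ : psi @^-1` _ = U); first exact: thX.
  by apply/seteqP; split=> y /=; rewrite Kp.
move=> F RF z.
have E : F = (F \o psi) \o phi by apply/funext => y /=; rewrite pK.
have RF' : Rset c (F \o psi) by apply/(Rset_ref _ _ rphi); rewrite -E.
by have := red _ RF' (phi z); rewrite /= -pv !pK.
Qed.

End Firing.

(** * The divisor of a special open set *)

Section Layered.
Context (R : realType).

Definition lower (G : metric_graph R) (U : set G) (h : G -> R) (z : G) : set G :=
  [set w | ~ U w /\ h w < h z].

(* The divisor attached to a height function h: off U, the number of directions at z
   leading into U or downwards, minus one. *)
Definition height_div (G : metric_graph R) (U : set G) (h : G -> R) (z : G) : int :=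
  if `[< U z >] then 0 else valency_in U z + valency_in (lower U h z) z - 1.

(** The nonzero slope makes [h] strictly monotone on each edge outside [U], so that every direction
    along it goes strictly up or strictly down. *)
Definition height_fun (G : metric_graph R) (U : set G) (h : G -> R) :=
  [/\ open U, edge_adapted U &
    forall e, ~~ inner U e -> exists a b, b != 0 /\ forall t, 0 <= t <= len e -> h (chart e t) = a + b * t].

Definition layered (G : metric_graph R) (U : set G) (h : G -> R) :=
  height_fun U h /\ forall z, ~ U z -> 2 <= valency_in U z \/ 1 <= valency_in (lower U h z) z.

Lemma ref_height_div (H G : metric_graph R) (phi : H -> G) (U : set G) (h : G -> R) z :
  refinement phi -> height_div (phi @^-1` U) (h \o phi) z = height_div U h (phi z).
Proof. by move=> rphi; rewrite /height_div -!ref_valency. Qed.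

Lemma ref_edge_in (H G : metric_graph R) (phi : H -> G) e : refinement phi ->
  exists e' a, [/\ forall z, edge_in e z -> edge_in e' (phi z), 0 <= a, a + len e <= len e' &
    forall t, 0 <= t <= len e -> phi (chart e t) = chart e' (a + t)].
Proof.
move=> rphi; have [e' [a [a0 al E]]] := ref_chart rphi e; exists e', a; split=> //.
move=> z [t /=]; rewrite in_itv /= => ht <-; rewrite E; last lra.
by exists (a + t); rewrite //= in_itv /=; lra.
Qed.

Lemma ref_edge_adapted (H G : metric_graph R) (phi : H -> G) (U : set G) :
  refinement phi -> edge_adapted U -> edge_adapted (phi @^-1` U).
Proof.
move=> rphi aU e; have [e' [a [He _ _ _]]] := ref_edge_in e rphi.
have [eU|eU] := aU e'; [left|right]; first by move=> z /He /eU.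
apply/seteqP; split=> // z [/He ez /= Uz].
by have : (edge_in e' `&` U) (phi z) by []; rewrite eU.
Qed.

Lemma ref_layered (H G : metric_graph R) (phi : H -> G) (U : set G) (h : G -> R) :
  refinement phi -> layered U h -> layered (phi @^-1` U) (h \o phi).
Proof.
move=> rphi [[oU aU hU] vU]; split.
  split; [exact/(ref_open _ rphi)|exact: ref_edge_adapted|move=> e ne].
  have [e' [a [He a0 al E]]] := ref_edge_in e rphi.
  have ne' : ~~ inner U e'.
    by apply: contra ne => /asboolP ie; apply/asboolP => z /He /ie.
  have [b [k [k0 hk]]] := hU e' ne'; exists (b + k * a), k; split=> // t ht.
  by rewrite /= E // hk; lra.
by move=> z /= /vU; rewrite -!(ref_valency _ _ rphi).
Qed.

Section Values.
Context (G : metric_graph R) (U : set G) (h : G -> R).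
Hypothesis lU : height_fun U h.
Implicit Types (d : edge G * bool) (e : edge G) (p q : vert G) (z : G).

Let oU : open U. Proof. by case: lU. Qed.
Let aU : edge_adapted U. Proof. by case: lU. Qed.

Lemma height_dart d : ~~ inner U d.1 -> exists2 b, b != 0 &
  forall u, 0 <= u <= len d.1 -> h (dart_chart d u) = h (inl (org d)) + b * u.
Proof.
case: lU => _ _ hU; move=> /hU [a [b [b0 hb]]]; have l0 := len_gt0 d.1.
case: d hb l0 => e [] /= hb l0.
  exists b => // u hu; rewrite -dart_chart0 dart_chart_true /dart_chart /= !hb; lra.
exists (- b) => [|u hu]; first by rewrite oppr_eq0.
rewrite -dart_chart0 /dart_chart /= !hb; lra.
Qed.

Lemma near_lower d (s : R) : ~~ inner U d.1 -> 0 <= s < len d.1 ->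
  forall b, (forall u, 0 <= u <= len d.1 -> h (dart_chart d u) = h (inl (org d)) + b * u) ->
  (\forall k \near 0^'+, lower U h (dart_chart d s) (dart_chart d (s + k))) <-> b < 0.
Proof.
move=> nd hs b hb; split=> [/near0P[r r0 Hr]|b0].
  have sl : 0 < len d.1 - s by lra.
  have [k [kr ks]] := lt2_ex r0 sl.
  have [_] := Hr k kr; rewrite !hb; [|lra|lra] => hlt.
  have : b * k < 0 * k by lra.
  by rewrite ltr_pM2r //; case/andP: kr.
apply/near0P; exists (len d.1 - s) => [|k hk]; first lra.
split; first by apply: (outerP aU nd); apply: edge_inP; lra.
rewrite !hb; [|lra|lra].
have : b * k < 0 * k by rewrite ltr_pM2r //; lra.
lra.
Qed.

Lemma lower_inner d p : inner U d.1 ->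
  ~ \forall k \near 0^'+, lower U h (inl p) (dart_chart d (0 + k)).
Proof.
move=> /(near_dartP aU d) nU nL.
by have [k [[nUk _] Uk]] := filter_ex (filterI nL nU).
Qed.

Definition down d := ~~ inner U d.1 && (h (inl (tip d)) < h (inl (org d))).

Lemma near_lower_vert d :
  (\forall k \near 0^'+, lower U h (inl (org d)) (dart_chart d (0 + k))) <-> down d.
Proof.
rewrite /down; have [id|nd] := boolP (inner U d.1); first by split=> // /(lower_inner id).
have [b b0 hb] := height_dart nd.
have l0 := len_gt0 d.1.
have := @near_lower d 0 nd _ b hb; rewrite lexx l0 dart_chart0 => /(_ isT) ->.
rewrite -dart_chart_len hb; last lra.
rewrite gtrDl pmulr_llt0 //.
Qed.

Lemma down_rv d : ~~ inner U d.1 -> down (rv d) = ~~ down d.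
Proof.
move=> nd; rewrite /down tip_rv org_rv /= nd /=.
have [b b0 hb] := height_dart nd; have l0 := len_gt0 d.1.
have : h (inl (tip d)) != h (inl (org d)).
  rewrite -dart_chart_len hb; last lra.
  by rewrite -subr_eq0 addrC addKr mulf_neq0 // gt_eqF.
by case: ltgtP.
Qed.

Lemma valency_vert (S : set G) p : valency_in S (inl p) =
  \sum_(d | org d == p) indic (\forall k \near 0^'+, S (dart_chart d (0 + k))).
Proof.
rewrite /valency_in /germ_sum [RHS]big_mkcond; apply: eq_bigr => d _.
by rewrite dart_pos_inl; case: eqP.
Qed.

Lemma valency_in_inner p : valency_in U (inl p) = \sum_(d | org d == p) (inner U d.1)%:Z.
Proof.
rewrite valency_vert; apply: eq_bigr => d _.
by rewrite (indic_iff (near_dartP aU d)) /indic; case: ifP => /asboolP; case: inner.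
Qed.

Lemma valency_in_down p : valency_in (lower U h (inl p)) (inl p) = \sum_(d | org d == p) (down d)%:Z.
Proof.
rewrite valency_vert; apply: eq_bigr => d /eqP <-.
by rewrite (indic_iff (near_lower_vert d)) /indic; case: ifP => /asboolP; case: down.
Qed.

(** Exactly one of the two directions goes down, by strict monotonicity; this leaves no chip of
    [height_div] inside an edge. *)
Lemma valency_edge e z : edge_in e z -> ~ U z ->
  valency_in U z = 0 /\ valency_in (lower U h z) z = 1.
Proof.
move=> ez nUz.
have ne : ~~ inner U e by apply/negP => /innerP/(_ ez).
have nU w : edge_in e w -> ~ U w := outerP aU ne (z := w).
move: ez nUz => [t /=]; rewrite in_itv /= => ht <- nUz.
have nd s d : d.1 = e -> 0 <= s < len e -> ~ \forall k \near 0^'+, U (dart_chart d (s + k)).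
  move=> de hs nk; have nk' : \forall k \near 0^'+, edge_in e (dart_chart d (s + k)).
    by apply/near0P; exists (len e - s) => [|k hk]; [|rewrite -de; apply: edge_inP; rewrite de]; lra.
  by have [k [Uk ek]] := filter_ex (filterI nk nk'); exact: nU ek Uk.
have germE (Psi : (R -> G) -> int) : germ_sum Psi (chart e t) =
    Psi (fun k => dart_chart (e, true) (t + k)) + Psi (fun k => dart_chart (e, false) (len e - t + k)).
  rewrite /germ_sum (bigD1 (e, true)) // (bigD1 (e, false)); last by apply/eqP => -[].
  rewrite /= big1 ?addr0; first by rewrite !dart_pos_in //= eqxx.
  move=> [e' b] /andP[/eqP h1 /eqP h2]; rewrite dart_pos_in //=.
  by case: eqP => // ee; case: b h1 h2; rewrite ee.
rewrite /valency_in !germE !(indicF (nd _ _ _ _)) //=; [|lra|lra].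
split; first by rewrite addr0.
have [b b0 hb] := @height_dart (e, true) ne.
have ht1 : 0 <= t < len (e, true).1 by rewrite /=; lra.
have ht2 : 0 <= len e - t < len (e, false).1 by rewrite /=; lra.
have hb' u : 0 <= u <= len (e, false).1 -> h (dart_chart (e, false) u) = h (inl (org (e, false))) + - b * u.
  rewrite /= => hu; rewrite -dart_chart0 !(dart_chart_rv (e, true)) !hb /=; lra.
have := near_lower (d := (e, true)) ne ht1 hb; rewrite dart_chart_true => /indic_iff ->.
have E2 : dart_chart (e, false) (len e - t) = chart e t by rewrite /dart_chart /= subKr.
have := near_lower (d := (e, false)) ne ht2 hb'; rewrite E2 => /indic_iff ->.
rewrite oppr_lt0 /indic !asboolb; case: ltgtP b0 => //=.
Qed.

Lemma height_div_edge e z : edge_in e z -> height_div U h z = 0.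
Proof.
move=> ez; rewrite /height_div; case: asboolP => // nUz.
by have [-> ->] := valency_edge ez nUz.
Qed.

Lemma height_div_vert p : ~ U (inl p) -> height_div U h (inl p) =
  \sum_(d | org d == p) ((inner U d.1)%:Z + (down d)%:Z) - 1.
Proof.
by move=> nU; rewrite /height_div asboolF // big_split /= valency_in_inner valency_in_down.
Qed.

Lemma height_div_ge0 z : (forall z, ~ U z -> 2 <= valency_in U z \/ 1 <= valency_in (lower U h z) z) ->
  0 <= height_div U h z.
Proof.
move=> vU; rewrite /height_div; case: asboolP => // nUz; move: (vU z nUz).
have v0 S : 0 <= valency_in S z.
  by apply: sumr_ge0 => d _; case: dart_pos => // s; exact: indic_ge0.
by have := v0 U; have := v0 (lower U h z); lia.
Qed.

Lemma slope_lt0 F m (g : R -> G) : germ_slope F m g ->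
  (\forall k \near 0^'+, F (g k) < F (g 0)) -> m <= -1.
Proof.
move=> sm lt; have m0 : m <= 0.
  by apply: slope_le0 sm _; apply: filterS lt => k; exact: ltW.
suff : m != 0 by lia.
apply/eqP => mz.
have [k //] : exists k : R, False.
apply: (@filter_ex _ (0^'+)); apply: filterS2 sm lt => k ->.
by rewrite mz mul0r addr0 ltxx.
Qed.

(** If the maximum of [F] is attained in [U], then [F] is constant on [U]. Otherwise take the lowest
    vertex [p] where it is attained: each dart into [U] or downwards has slope at most -1 and the
    others at most 0, so the minus one in [height_div] makes the coefficient at [p] negative. *)
Lemma height_div_avoid F : connected U -> Rset (height_div U h) F ->
  forall z, U z -> height_div U h z + ord F z = 0.
Proof.
move=> cU RF.
have cF := Rset_convex height_div_edge RF; have rF := RF.1.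
have [v _] : exists v : vert G, True by move/card_gt0P: (vert_nonempty G) => [v _]; exists v.
pose pm := [arg max_(p > v) F (inl p)]%O.
pose M := F (inl pm).
have FMv p : F (inl p) <= M by rewrite /M /pm; case: arg_maxP => // i _; apply.
(* By convexity [F] is below the [interp] of the constant [M], which is again [M]. *)
have FM z : F z <= M.
  have := @le_interp _ _ F (fun _ => M) z rF cF FMv; congr (_ <= _).
  have fl0 d : fl (fun=> M) d = 0 :> int by rewrite /fl subrr mul0r floor0.
  by case: z => [//|[e t]] /=; rewrite !fl0 !mul0r addr0 maxxx.
have dU z : U z -> height_div U h z = 0 by move=> Uz; rewrite /height_div asboolT.
have [[z0 [Uz0 Fz0]]|nM] := pselect (exists z, U z /\ F z = M).
  have FU : forall z, U z -> F z = M.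
    apply: (max_principle rF oU cU _ _ Uz0) => // z Uz.
    by have := RF.2 z; rewrite dU // add0r.
  by move=> z Uz; rewrite dU // add0r; exact: ord_cst_open oU Uz FU.
exfalso.
have lt z : U z -> F z < M.
  by move=> Uz; rewrite lt_neqAle FM andbT; apply/eqP => E; apply: nM; exists z.
pose p := [arg min_(q < pm | F (inl q) == M) h (inl q)]%O.
have [Fp hp] : F (inl p) = M /\ forall q, F (inl q) = M -> h (inl p) <= h (inl q).
  by rewrite /p; case: arg_minP => // i /eqP Fi Hi; split=> // q /eqP /Hi.
have nUp : ~ U (inl p) by move=> /lt; rewrite Fp ltxx.
have := RF.2 (inl p); rewrite height_div_vert // ord_vert addrAC -big_split /=.
suff : \sum_(d | org d == p) ((inner U d.1)%:Z + (down d)%:Z + outgoing_slope F d 0) <= 0.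
  by move=> h1; rewrite subr_ge0 => /le_trans/(_ h1).
apply: sumr_le0 => d /eqP od.
have sl : germ_slope F (outgoing_slope F d 0) (fun k => dart_chart d (0 + k)).
  by apply: rational_slope => //; rewrite lexx len_gt0.
have s0 : outgoing_slope F d 0 <= 0.
  by apply: slope_le0 sl _; apply: nearW => k; rewrite addr0 dart_chart0 od Fp.
have [id|nd] := boolP (inner U d.1).
  rewrite /down id /= addr0.
  suff : outgoing_slope F d 0 <= -1 by lia.
  apply: slope_lt0 sl _; have := (near_dartP aU d).2 id.
  by apply: filterS => k Uk; rewrite addr0 dart_chart0 od Fp; exact: lt.
rewrite add0r; have [dd|] := boolP (down d); last by rewrite add0r.
suff : outgoing_slope F d 0 < 0 by rewrite /=; lia.
have := @tangent_le _ _ F d 0 rF cF; rewrite lexx len_gt0 => /(_ isT).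
rewrite dart_chart0 od Fp subr0 => tl.
have ltt : F (inl (tip d)) < M.
  rewrite lt_neqAle FM andbT; apply/eqP => /hp; rewrite leNgt.
  by move: dd; rewrite /down od => /andP[_ ->].
have : (outgoing_slope F d 0)%:~R * len d.1 < 0 by lra.
by rewrite pmulr_llt0 ?len_gt0 // (ltr_int _ _ 0).
Qed.

End Values.
End Layered.

(** * Chips at every point off the special set *)

Section Cover.
Context (R : realType) (G : metric_graph R) (U : set G) (h : G -> R).
Hypothesis layU : layered U h.
Implicit Types (d : edge G * bool) (e : edge G) (p q r : vert G) (z : G) (w : pred (edge G * bool)).

Let lU : height_fun U h. Proof. by case: layU. Qed.
Let oU : open U. Proof. by case: lU. Qed.
Let aU : edge_adapted U. Proof. by case: lU. Qed.

Let outer d := ~~ inner U d.1.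

Lemma height_ind (P : vert G -> Prop) :
  (forall p, (forall q, h (inl q) < h (inl p) -> P q) -> P p) -> forall p, P p.
Proof.
move=> H p; have [n] := ubnP #|[pred q | h (inl q) < h (inl p)]|.
elim: n p => // n IH p; rewrite ltnS => hn; apply: H => q qp; apply: IH.
apply: leq_trans hn; apply: proper_card; apply/properP; split.
  by apply/fintype.subsetP => r; rewrite !inE => /lt_trans; apply.
by exists q; rewrite !inE // ltxx.
Qed.

Definition exits p : int := \sum_(d | org d == p) (inner U d.1)%:Z.

Lemma exits_ge0 p : 0 <= exits p.
Proof. by apply: sumr_ge0. Qed.

Lemma exits_gt0 d : inner U d.1 -> 1 <= exits (org d).
Proof. by move=> id; rewrite /exits (bigD1 d) //= id lerDl sumr_ge0. Qed.

Lemma exits_inner p : 1 <= exits p -> exists d, org d = p /\ inner U d.1.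
Proof.
move=> e1; apply: contrapT => nd; move: e1; rewrite /exits big1 // => d /eqP od.
by case: (boolP (inner U d.1)) => // id; case: nd; exists d.
Qed.

Lemma exits_or_down p : ~ U (inl p) -> 2 <= exits p \/ exists d, org d = p /\ down U h d.
Proof.
case: layU => _ H /H []; first by rewrite (valency_in_inner lU); left.
rewrite (valency_in_down lU) => d1; right; apply: contrapT => nd.
move: d1; rewrite big1 // => d /eqP od.
by case: (boolP (down U h d)) => // dd; case: nd; exists d.
Qed.

(* w d: the edge of d is oriented towards the origin of d. *)
Definition orientation w :=
  (forall d, outer d -> w (rv d) = ~~ w d) /\ forall d, inner U d.1 -> ~~ w d.

Definition indegree w p : int := \sum_(d | org d == p) (w d)%:Z.

(* Reversing a downward path from y to a vertex r with two exits. *)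
Lemma reorient y : ~ U (inl y) -> exists w r,
  [/\ orientation w,
      forall d, h (inl y) < h (inl (org d)) \/ h (inl y) < h (inl (tip d)) -> w d = down U h d,
      2 <= exits r &
      forall p, indegree w p + (p == y)%:Z = indegree (down U h) p + (p == r)%:Z].
Proof.
elim/height_ind: y => y IH nUy.
have [ey|[d0 [od0 dd0]]] := exits_or_down nUy.
  exists (down U h), y; split=> //; split=> [d nd|d id]; first exact: (down_rv lU).
  by rewrite /down id.
have /andP[nd0 hd0] := dd0; rewrite od0 in hd0.
have nUq : ~ U (inl (tip d0)) by rewrite -org_rv; exact: outer_vert.
have [w [r [[w1 w2] w3 er wE]]] := IH _ hd0 nUq.
pose w' d := if (d == d0) || (d == rv d0) then ~~ w d else w d.
(* The origin [y] of [d0] is above [tip d0], so the orientation obtained from the induction has not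
   touched this edge. *)
have wd0 : w d0 by rewrite w3 // od0; left.
have wrd0 : w (rv d0) = false by rewrite w1 ?wd0.
have d0r : d0 != rv d0 by case: (d0) => e []; apply/eqP => -[].
exists w', r; split=> //.
- split=> d nd; rewrite /w'.
    rewrite (inj_eq (can_inj (@rvK R G))) (can2_eq (@rvK R G) (@rvK R G)) orbC.
    by case: ifP => _; rewrite w1.
  case: ifP => [/orP[]/eqP E|_]; last exact: w2.
    by rewrite E (negbTE nd0) in nd.
  by rewrite E /= (negbTE nd0) in nd.
- move=> d hd; rewrite /w' ifF; first by apply: w3; case: hd => hd; [left|right]; exact: lt_trans hd.
  apply/negP => /orP[]/eqP E; move: hd; rewrite E ?tip_rv ?org_rv od0 ltxx ltNge (ltW hd0);
  by case.
(* Flipping the edge of [d0] moves one unit of indegree from [y] to [tip d0]; the rest of the path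
   is covered by the induction. *)
- move=> p; rewrite -wE.
  suff : indegree w' p + (p == y)%:Z = indegree w p + (p == tip d0)%:Z by [].
  pose f (v : pred (edge G * bool)) d : int := if org d == p then (v d)%:Z else 0.
  have E v : indegree v p = f v d0 + (f v (rv d0) + \sum_(d | (d != d0) && (d != rv d0)) f v d).
    by rewrite /indegree big_mkcond (bigD1 d0) //= (bigD1 (rv d0)) //= eq_sym.
  rewrite !E (_ : \sum_(d | _) f w' d = \sum_(d | (d != d0) && (d != rv d0)) f w d); last first.
    by apply: eq_bigr => d /andP[n1 n2]; rewrite /f /w' (negbTE n1) (negbTE n2).
  rewrite /f /w' !eqxx orbT /= wd0 wrd0 od0 org_rv (eq_sym y) (eq_sym (tip d0)).
  move: (\sum_(d | _) _) => S.
  by case: (p == y); case: (p == tip d0); rewrite /=; lia.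
Qed.

(** The vertices in the closure of [U], at distance 0. *)
Definition in_contact p := U (inl p) \/ exists d, org d = p /\ inner U d.1.

Lemma inner_contact d : inner U d.1 -> in_contact (org d) /\ in_contact (tip d).
Proof. by move=> id; split; right; [exists d|exists (rv d)]. Qed.

Let cost w d : R := if w d then len d.1 else 0.

Let cost_ge0 w d : 0 <= cost w d.
Proof. by rewrite /cost; case: ifP => // _; rewrite ltW // len_gt0. Qed.

(* The distance to U for which moving along the orientation is free. *)
Lemma potential w : exists T : vert G -> R,
  [/\ forall p, in_contact p -> T p = 0,
      forall d, outer d -> T (tip d) <= T (org d) + cost w d &
      forall p, ~ in_contact p -> exists d, [/\ outer d, tip d = p & T p = T (org d) + cost w d]].
Proof.
(* The distance is built as the pointwise largest function satisfying the first two conditions,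
   which avoids a minimum over paths. *)
pose X := [set x : vert G -> R | (forall p, in_contact p -> x p = 0) /\
  forall d, outer d -> x (tip d) <= x (org d) + cost w d].
have X0 : X (fun _ => 0) by split=> // d _; rewrite add0r; exact: cost_ge0.
(* Descending from [p] leads to a vertex in contact with [U], which bounds the value at [p]. *)
have bd p : exists C : R, forall x, X x -> x p <= C.
  elim/height_ind: p => p IH.
  have [cp|ncp] := pselect (in_contact p); first by exists 0 => x [/(_ p cp) -> _].
  have [|e2|[d [od /andP[nd hd]]]] := @exits_or_down p.
  - by move=> Up; apply: ncp; left.
  - by exfalso; have [|d id] := @exits_inner p; [lia|apply: ncp; right; exists d].
  - rewrite od in hd; have [C HC] := IH _ hd; exists (C + cost w (rv d)) => x Xx.
    have := Xx.2 (rv d) nd; rewrite tip_rv od org_rv; have := HC x Xx; lra.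
pose S p := [set x p | x in X].
have hS p : has_sup (S p).
  split; first by exists 0, (fun=> 0).
  by have [C HC] := bd p; exists C => _ [x Xx <-]; exact: HC.
pose T p := sup (S p).
have leT x p : X x -> x p <= T p by move=> Xx; apply: sup_upper_bound => //; exists x.
have T0 p : in_contact p -> T p = 0.
  move=> cp; apply/eqP; rewrite eq_le (leT _ p X0) andbT.
  by apply: ge_sup; [exact: (hS p).1|move=> _ [x [/(_ p cp) -> _] <-]].
have Td d : outer d -> T (tip d) <= T (org d) + cost w d.
  move=> nd; apply: ge_sup; first exact: (hS _).1.
  move=> _ [x Xx <-]; apply: le_trans (Xx.2 d nd) _.
  by rewrite lerD2r; exact: leT.
exists T; split=> // p ncp; apply: contrapT => nt.
(* If no constraint at [p] were tight, there would be a positive margin [r], and raising [T p] by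
   [r / 2] would contradict maximality. *)
have [r r0 Hr] : exists2 r, 0 < r & forall k, 0 < k < r -> forall d,
    outer d -> tip d = p -> T p + k <= T (org d) + cost w d.
  apply/near0P; apply: filter_forall => d; apply/near0P.
  have [[nd td]|nn] := pselect (outer d /\ tip d = p); last first.
    by exists 1 => // k _ nd td; case: nn.
  exists (T (org d) + cost w d - T p).
    rewrite subr_gt0 lt_neqAle -{2}td Td // andbT; apply/eqP => E.
    by apply: nt; exists d.
  by move=> k hk _ _; lra.
pose x q := T q + (if q == p then r / 2 else 0).
have xT q : T q <= x q by rewrite /x; case: ifP; lra.
suff : X x by move=> /(leT _ p); rewrite /x eqxx; lra.
split=> [q cq|d nd].
  rewrite /x T0 // add0r; case: eqP => // E; by rewrite -E in ncp.
rewrite {1}/x; case: eqP => [td|_]; last first.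
  by rewrite addr0; apply: le_trans (Td d nd) _; rewrite lerD2r.
by rewrite td; apply: le_trans (Hr (r / 2) _ d nd td) _; [lra|rewrite lerD2r].
Qed.

(** With [x] equal to [- T], each [fl x d] is at least [- w d], so the loss at [p] is at most
    [indegree w p]. By [reorient] this indegree differs from that of [down] by one at [y] and one at
    [r], and the chips can pay. *)
Lemma height_div_cover y : ~ U (inl y) ->
  exists F, Rset (height_div U h) F /\ 1 <= height_div U h (inl y) + ord F (inl y).
Proof.
move=> nUy; have [w [r [[w1 w2] _ er wE]]] := reorient nUy.
have [T [T0 Td Tt]] := potential w.
pose x p := - T p.
(* One chip is removed at [y] in advance, so that effectivity leaves a chip there. *)
pose c z := height_div U h z - indic (z = inl y).
have cV e z : edge_in e z -> c z = 0.
  move=> ez; rewrite /c (height_div_edge lU ez) indicF // => zy.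
  by apply: (@edge_in_vert _ _ e y); rewrite -zy.
have cr : in_contact r.
  by right; apply: exits_inner; lia.
have fl_inner d : inner U d.1 -> fl x d = 0.
  by move=> /inner_contact[c1 c2]; rewrite /fl /x !T0 // subrr mul0r floor0.
have fl_w d : - (w d)%:Z <= fl x d.
  have [id|nd] := boolP (inner U d.1); first by rewrite fl_inner // (negbTE (w2 d id)).
  have := Td d nd; rewrite fl_ge /x mulrNz mulNr /cost.
  by case: (w d) => /=; rewrite ?mul1r ?mul0r; lra.
have feas : feasible c x.
  move=> p; have [Up|nUp] := pselect (U (inl p)).
    rewrite /c /height_div asboolT // indicF ?subr0 ?add0r; last by move=> [E]; rewrite -E in nUy.
    apply: sumr_ge0 => d /eqP od; rewrite fl_inner //.
    by apply: (vert_inner oU aU); rewrite od.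
  rewrite /c (height_div_vert lU nUp) big_split /=.
  rewrite -/(exits p) -/(indegree (down U h) p).
  have -> : indic ((inl p : G) = inl y) = (p == y)%:Z.
    by case: eqP => [->|E]; [rewrite indicT|rewrite indicF // => -[]].
  have wEp := wE p; have e0 := exits_ge0 p.
  have sw : \sum_(d | org d == p) - (w d)%:Z = - indegree w p by rewrite sumrN.
  have [cp|ncp] := pselect (in_contact p).
    have : - indegree w p <= \sum_(d | org d == p) fl x d.
      by rewrite -sw; apply: ler_sum => d _; exact: fl_w.
    have : 1 <= exits p.
      by case: cp => // -[d [<- id]]; exact: exits_gt0.
    (* The reversal costs one more chip at [r], paid by its second exit. *)
    have : (p == r)%:Z + 1 <= exits p.
      case: eqP => [->//|_]; by case: cp => // -[d [<- id]]; exact: exits_gt0.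
    move: (indegree w p) (indegree _ p) (exits p) (\sum_(_ | _) _) wEp => a b k S.
    by clear; lia.
  have pr : p == r = false by apply/eqP => E; rewrite -E in cr.
  (* Here no exit makes up for the minus one in [height_div]. The tight dart does: along its
     reverse, [fl x] exceeds the bound of [fl_w] by at least one. *)
  have [d [nd td tE]] := Tt p ncp.
  have : - indegree w p + 1 <= \sum_(d | org d == p) fl x d.
    rewrite -sw (bigD1 (rv d)) /= ?org_rv ?td // [leRHS](bigD1 (rv d)) /= ?org_rv ?td //.
    rewrite addrAC; apply: lerD; last by apply: ler_sum => d' _; exact: fl_w.
    rewrite w1 // fl_ge tip_rv org_rv td /x tE /cost.
    by case: (w d) => /=; rewrite ?addNr ?oppr0 ?add0r ?mul0r ?mul1r; lra.
  move: wEp; rewrite pr; move: (indegree w p) (indegree _ p) (exits p) (\sum_(_ | _) _) e0 => a b k S.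
  by clear; lia.
have [rF cF] := Rset_interp cV feas.
exists (interp x); split; last first.
  by have := cF (inl y); rewrite /c indicT //; lia.
split=> // z; have := cF z; rewrite /c; have := indic_ge0 (z = inl y); lia.
Qed.

End Cover.

(** Breadth-first distance from [A], made injective; the predecessor on a shortest path is strictly
    closer to [A]. *)
Lemma rank_function (T : finType) (e : rel T) (A : pred T) : exists h : T -> nat,
  injective h /\ forall p, (exists r, A r /\ connect e r p) -> A p \/ exists q, e q p /\ (h q < h p)%N.
Proof.
pose D p n := [exists r, A r && [exists s : n.-tuple T, path e r s && (last r s == p)]].
have DP p n : reflect (exists r s, [/\ A r, size s = n, path e r s & last r s = p]) (D p n).
  apply: (iffP existsP) => [[r /andP[Ar /existsP[s /andP[es /eqP sp]]]]|[r [s [Ar sn es sp]]]].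
    by exists r, s; split=> //; rewrite size_tuple.
  exists r; rewrite Ar /=; apply/existsP; exists (tcast sn (in_tuple s)).
  by rewrite val_tcast es sp eqxx.
pose dist p := if pselect (exists n, D p n) is left H then ex_minn H else 0%N.
have distP p n : D p n -> D p (dist p) /\ (dist p <= n)%N.
  move=> Dn; rewrite /dist; case: pselect => [H|nH]; last by case: nH; exists n.
  by case: ex_minnP => m Dm Hm; split=> //; exact: Hm.
(* Lexicographic: distance first, ties broken by the enumeration of [T], whose ranks are below
   [#|T|]. *)
pose h p := (dist p * #|T| + enum_rank p)%N.
exists h; split=> [p q E|p [r [Ar /connectP[s es sp]]]].
  have := congr1 (fun n => (n %% #|T|)%N) E; rewrite /h !modnMDl !modn_small //.
  by move=> /val_inj/enum_rank_inj.
have [|+ _] := distP p (size s); first by apply/DP; exists r, s.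
move=> /DP[r' [s' [Ar' sz es' sp']]].
case: (lastP s') sz es' sp' => [|s'' x] sz; first by move=> _ /= <-; left.
rewrite rcons_path last_rcons => /andP[es'' ex] xp; subst x; right.
exists (last r' s''); split=> //.
have [|_ dq] := distP (last r' s'') (size s''); first by apply/DP; exists r', s''.
rewrite /h -sz size_rcons mulSn.
apply: leq_trans (_ : (size s'' * #|T| + #|T| <= _)%N); last by rewrite (addnC #|T|) leq_addr.
rewrite -addnS; apply: leq_add; first by rewrite leq_mul2r dq orbT.
exact: ltn_ord.
Qed.

(** * Heights and divisors for special open sets *)

Section Existence.
Context (R : realType).

Section HeightOfRank.
Context (G : metric_graph R) (U : set G) (k : vert G -> nat).

Definition linear_height (z : G) : R :=
  match z with
  | inl p => (k p)%:R
  | inr (existT e t) => (k (src e))%:R + ((k (tgt e))%:R - (k (src e))%:R) / len e * val t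
  end.

Lemma linear_height_chart e t : 0 <= t <= len e ->
  linear_height (chart e t) = (k (src e))%:R + ((k (tgt e))%:R - (k (src e))%:R) / len e * t.
Proof.
move=> /andP[t0 tl]; have l0 := len_gt0 e; have [->|tn0] := eqVneq t 0.
  by rewrite chart0 mulr0 addr0.
have [->|tnl] := eqVneq t (len e).
  by rewrite chart_len /= divfK ?gt_eqF // addrC subrK.
have ht : 0 < t < len e by rewrite !lt_neqAle t0 tl tnl eq_sym tn0.
by rewrite (chart_in ht).
Qed.

Lemma height_fun_linear : open U -> edge_adapted U -> injective k ->
  height_fun U linear_height.
Proof.
move=> oU aU ki; split=> // e _; have l0 := len_gt0 e.
exists (k (src e))%:R, (((k (tgt e))%:R - (k (src e))%:R) / len e); split.
  apply: mulf_neq0; last by rewrite invr_eq0 gt_eqF.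
  by rewrite subr_eq0 eqr_nat (inj_eq ki) eq_sym loopless.
exact: linear_height_chart.
Qed.

End HeightOfRank.

(** Roots are the vertices with two directions into [U]. The part off [U] that no root reaches
    through edges outside [U] is clopen and has no root, so specialness makes it empty.
    Breadth-first ranks from the roots then serve as heights. *)
Lemma special_layered (G : metric_graph R) (U : set G) : special U -> edge_adapted U ->
  exists h, layered U h.
Proof.
move=> [oU cU _ HU] aU.
pose root p := [exists d, exists d', [&& org d == p, org d' == p, inner U d.1, inner U d'.1 & d != d']].
pose adj p q := [exists d, [&& ~~ inner U d.1, org d == p & tip d == q]].
pose reach p := exists r, root r /\ connect adj r p.
have adjP d : ~~ inner U d.1 -> adj (org d) (tip d).
  by move=> nd; apply/existsP; exists d; rewrite nd !eqxx.
have reach_adj d : ~~ inner U d.1 -> reach (org d) -> reach (tip d).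
  move=> nd [r [rr cr]]; exists r; split=> //; apply: connect_trans cr _.
  exact/connect1/adjP.
have src_org d : reach (src d.1) -> ~~ inner U d.1 -> reach (org d).
  case: d => e [] //= rs nd; rewrite -tip_rv; exact: reach_adj.
have org_src d : reach (org d) -> ~~ inner U d.1 -> reach (src d.1).
  case: d => e [] //= rs nd.
  by rewrite (_ : src e = tip (e, false)) //; exact: reach_adj.
(* An open edge is judged by its source, as its two ends are reached together. *)
pose X := [set z : G | (exists p, [/\ z = inl p, ~ U z & ~ reach p]) \/
  exists e, [/\ edge_in e z, ~~ inner U e & ~ reach (src e)]].
have X_edge e z : edge_in e z -> ~~ inner U e -> X z <-> ~ reach (src e).
  move=> ez ne; split=> [[[p [zp _ _]]|[e' [ez' _ nr]]]|nr].
  - by case: (@edge_in_vert _ _ e p); rewrite -zp.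
  - by rewrite (edge_in_inj ez ez').
  - by right; exists e.
have X_vert p : X (inl p) <-> ~ U (inl p) /\ ~ reach p.
  split=> [[[q [[->] ]]|[e [/edge_in_vert]]]|[nU nr]] //.
  by left; exists p.
have XU : X `<=` ~` U.
  by move=> z [[p [zp nU _]]|[e [ez ne _]]] //; exact: (outerP aU ne ez).
have near_edge z e (S : set G) : edge_in e z -> (forall w, edge_in e w -> S w) ->
    germs z (fun g => \forall h \near 0^'+, S (g h)).
  move=> ez HS d s ps.
  have := (openP _).1 (@edge_in_open _ _ e) z ez d s ps.
  by apply: filterS => h /HS.
have near_vert p (S : set G) : (forall d, org d = p -> forall w, edge_in d.1 w -> S w) ->
    germs (inl p) (fun g => \forall h \near 0^'+, S (g h)).
  move=> HS d s; rewrite dart_pos_inl; case: eqP => // od [<-].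
  by apply: near_dart => u hu; apply: (HS d) => //; exact: edge_inP.
have cX : closed X.
  rewrite -[X in closed X]setCK closedC; apply/openP => z nX.
  have [[p zp]|[e ez]] := pointE z; last first.
    apply: (near_edge _ _ _ ez) => w ew Xw; apply: nX.
    have ne : ~~ inner U e by apply/negP => /innerP/(_ ew); exact: XU.
    by apply/(X_edge _ _ ez ne); apply/(X_edge _ _ ew ne).
  subst z; apply: near_vert => d od w ew Xw; apply: nX.
  have nd : ~~ inner U d.1 by apply/negP => /innerP/(_ ew); exact: XU.
  apply/X_vert; split; first by rewrite -od; exact: outer_vert.
  by move=> rp; apply: ((X_edge _ _ ew nd).1 Xw); apply: org_src nd; rewrite od.
have cY : closed (~` U `\` X).
  rewrite -[X in closed X]setCK closedC; apply/openP => z nY.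
  have UX : U z \/ X z.
    by have [|nU] := pselect (U z); [left|right; apply: contrapT => nX; apply: nY].
  case: UX => [Uz|Xz].
    by move=> d s ps; apply: filterS ((openP U).1 oU z Uz d s ps) => h Uh [].
  have [[p zp]|[e ez]] := pointE z; last first.
    apply: (near_edge _ _ _ ez) => w ew [nUw nXw]; apply: nXw.
    have ne : ~~ inner U e by apply/negP => /innerP/(_ ez); exact: XU.
    by apply/(X_edge _ _ ew ne); apply/(X_edge _ _ ez ne).
  subst z; apply: near_vert => d od w ew [nUw nXw]; apply: nXw.
  have nd : ~~ inner U d.1 by apply/negP => /innerP/(_ ew).
  apply/(X_edge _ _ ew nd) => rs; have [_ nr] := (X_vert p).1 Xz; apply: nr.
  by rewrite -od; exact: src_org.
have nX z : ~ X z.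
  move=> Xz; have [|z' Xz' nth] := HU X _ XU cX cY; first by exists z.
  have [d [d' [zd od' id id' dd]]] := not_thinP aU (XU z' Xz') nth.
  move: Xz'; rewrite zd => /X_vert[_]; apply; exists (org d); split; last exact: connect0.
  apply/existsP; exists d; apply/existsP; exists d'; rewrite eqxx od' eqxx id id' /=.
  exact/eqP.
have reachW p : ~ U (inl p) -> reach p.
  by move=> nU; apply: contrapT => nr; apply: (nX (inl p)); exact/X_vert.
have [k [ki Hk]] := rank_function adj root.
have hk := height_fun_linear oU aU ki.
exists (linear_height k); split=> // z nUz.
have [[p zp]|[e ez]] := pointE z; last by right; rewrite (valency_edge hk ez nUz).2.
subst z; case: (Hk p (reachW p nUz)) => [/existsP[d /existsP[d' /and5P[/eqP od /eqP od' id id' dd]]]|].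
  left; rewrite (valency_in_inner hk) (bigD1 d) ?od //= (bigD1 d') /= ?od' ?eqxx 1?eq_sym //.
  by rewrite id id' addrA lerDl sumr_ge0.
move=> [q [/existsP[d /and3P[nd /eqP od /eqP td]] kq]]; right.
rewrite (valency_in_down hk) (bigD1 (rv d)) /= ?org_rv ?td //.
by rewrite /down nd tip_rv org_rv td od /= ltr_nat kq lerDl sumr_ge0.
Qed.

Lemma special_div (G : metric_graph R) (U : set G) : special U -> exists c : G -> int,
  [/\ forall z, 0 <= c z, finite_set [set z | c z != 0],
      forall F, Rset c F -> forall z, U z -> c z + ord F z = 0 &
      forall y, ~ U y -> exists F, Rset c F /\ 1 <= c y + ord F y].
Proof.
move=> sU; have [oU cU [B /finite_seqP[s ->] cUB] _] := sU.
have [H [phi [rphi HP]]] := refinement_at s.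
have [psi [pK Kp cphi cpsi]] := ref_homeo rphi.
have sU' : special (phi @^-1` U) := special_homeo Kp pK cpsi cphi sU.
have [oU' cU' _ _] := sU'.
have aU' : edge_adapted (phi @^-1` U).
  apply: (@edge_adapted_boundary _ _ _ (phi @^-1` [set` s])) => //.
    by move/continuous_closedP : cphi => /(_ _ cUB).
  by move=> z /= /HP[p pz]; exists p; exact: (can_inj pK).
have [h lh] := special_layered sU' aU'; have [hh vh] := lh.
pose c := height_div (phi @^-1` U) h \o psi.
have cE : c \o phi = height_div (phi @^-1` U) h by apply/funext => z; rewrite /c /= pK.
exists c; split.
- by move=> z; exact: height_div_ge0.
- apply: (@sub_finite_set _ _ (phi @` range (@inl _ _ : vert H -> H))); last first.
    exact/finite_image/finite_image/finite_finset.
  move=> z /=; rewrite /c /= => cz; exists (psi z); rewrite ?Kp //.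
  have [[p ->]|[e ez]] := pointE (psi z); first by exists p.
  by rewrite (height_div_edge hh ez) in cz.
- move=> F RF z Uz; have RF' : Rset (height_div (phi @^-1` U) h) (F \o phi).
    by rewrite -cE; exact/Rset_ref.
  have := height_div_avoid hh cU' RF' (z := psi z).
  by rewrite /= ref_ord // Kp; exact.
- move=> y nUy.
  (* The point need not be a vertex of [H]. A further refinement makes it one, and [height_div]
     pulls back because it only counts directions. *)
  have [K [chi [rchi HK]]] := refinement_at [:: psi y].
  have [q qy] : exists q, chi (inl q) = psi y by apply: HK; rewrite inE.
  have [|F [RF F1]] := @height_div_cover _ _ _ _ (ref_layered rchi lh) q.
    by rewrite /= qy Kp.
  have [chi' cK Kc] := ref_bij rchi.
  have E : height_div (chi @^-1` (phi @^-1` U)) (h \o chi) = (c \o phi) \o chi.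
    by rewrite cE; apply/funext => z; rewrite ref_height_div.
  have EF : F = ((F \o chi' \o psi) \o phi) \o chi by apply/funext => z; rewrite /= pK cK.
  rewrite E EF in RF F1.
  exists (F \o chi' \o psi); split; first exact/(Rset_ref _ _ rphi)/(Rset_ref _ _ rchi).
  by move: F1; rewrite (ref_ord _ _ rchi) (ref_ord _ _ rphi) /= qy Kp.
Qed.

End Existence.

(** * Linear systems and ranks *)

Section Systems.
Context (R : realType) (G : metric_graph R).
Implicit Types (A : set G) (v z : G).
Local Notation divisor := {freeg (realization G) / int}.
Implicit Types D E : divisor.

Local Notation cf D := (fun z : G => coeff z D).

Lemma finite_support D : finite_set [set z : G | coeff z D != 0].
Proof. by apply/finite_seqP; exists (dom D); apply/seteqP; split=> z /=; rewrite mem_dom. Qed.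

Lemma divisor_of (c : G -> int) : finite_set [set z | c z != 0] ->
  exists D, forall z, coeff z D = c z.
Proof.
move=> /finite_seqP[s Hs]; exists (\sum_(z <- undup s) << c z *g z >>) => y.
rewrite raddf_sum /=; have [ys|ys] := boolP (y \in undup s).
  rewrite (bigD1_seq y) ?undup_uniq //= coeffU eqxx mulr1 big1 ?addr0 // => z zy.
  by rewrite coeffU (negbTE zy) mulr0.
rewrite big_seq big1 => [|z zs].
  apply/esym/eqP; apply: contraT => cy.
  have : [set z | c z != 0] y by [].
  by rewrite Hs /= -mem_undup (negbTE ys).
by rewrite coeffU; case: eqP => [E|_]; [rewrite -E zs in ys|rewrite mulr0].
Qed.

Lemma finite_support_ord D F : rational_function F ->
  finite_set [set z : G | coeff z D + ord F z != 0].
Proof.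
move=> rF; apply: (@sub_finite_set _ _
    ([set z : G | coeff z D != 0] `|` [set z | ord F z != 0])); last first.
  by rewrite finite_setU; split; [exact: finite_support|exact: ord_finite].
move=> z /=; apply: contraPP => /not_orP[/negP + /negP +]; rewrite !negbK => /eqP -> /eqP ->.
by rewrite addr0 eqxx.
Qed.

Lemma linear_system_of D F : Rset (cf D) F -> exists D',
  linear_system D D' /\ forall z, coeff z D' = coeff z D + ord F z.
Proof.
move=> [rF cF]; have [D' HD'] := divisor_of (finite_support_ord D rF).
exists D'; split=> //; split; first by move=> z; rewrite HD'.
by exists F; split=> // z; rewrite coeffB HD' addrAC subrr add0r.
Qed.

Lemma linear_systemP D : linear_system D !=set0 <-> exists F, Rset (cf D) F.
Proof.
split=> [[D' [eD' [F [rF HF]]]]|[F /linear_system_of[D' [lD' _]]]]; last by exists D'.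
by exists F; split=> // z; rewrite -HF coeffB addrC subrK; exact: eD'.
Qed.

Lemma suppP D v : supp_linear_system D v <-> exists F, Rset (cf D) F /\ 1 <= coeff v D + ord F v.
Proof.
split=> [[D' [[eD' [F [rF HF]]] D'v]]|[F [/linear_system_of[D' [lD' HD']] F1]]]; last first.
  by exists D'; split=> //; rewrite HD' gt_eqF.
have E z : coeff z D + ord F z = coeff z D' by rewrite -HF coeffB addrC subrK.
exists F; split; first by split=> // z; rewrite E; exact: eD'.
by rewrite E -gtz0_ge1 lt_neqAle eq_sym D'v; exact: eD'.
Qed.

Lemma supp_sub1 D v : supp_linear_system D v <-> linear_system (D - << v >>) !=set0.
Proof.
rewrite suppP linear_systemP; split=> [[F [RF F1]]|[F RF]]; exists F.
  split=> [|z]; first exact: RF.1.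
  rewrite coeffB coeffU mul1r; case: eqP => [<-|_]; last by rewrite subr0; exact: RF.2.
  by rewrite addrAC subr_ge0.
split; last by have := RF.2 v; rewrite coeffB coeffU eqxx mulr1 addrAC subr_ge0.
split=> [|z]; first exact: RF.1.
apply: le_trans (RF.2 z) _; rewrite coeffB coeffU lerD2r gerBl mul1r.
by case: eqP.
Qed.

(** The left side quantifies over divisors and so involves lengths; the right side is purely
    topological. *)
Lemma not_LsetP A v : A !=set0 ->
  ~ Lset A v <-> exists U, [/\ special U, U v & A `&` U = set0].
Proof.
move=> [a0 Aa0]; split=> [nL|[U [sU Uv AU]] L]; last first.
  have [c [c0 fc cU cN]] := special_div sU; have [D DE] := divisor_of fc.
  have DE' : cf D = c by apply/funext => z; rewrite DE.
  have AD : A `<=` supp_linear_system D.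
    move=> a Aa; apply/suppP; rewrite DE' DE; apply: cN => Ua.
    by have : (A `&` U) a by []; rewrite AU.
  have /suppP[F] := L D AD; rewrite DE' DE => -[RF].
  by rewrite (cU F RF v Uv).
have [D [AD nv]] : exists D, A `<=` supp_linear_system D /\ ~ supp_linear_system D v.
  apply: contrapT => H; apply: nL => D AD; apply: contrapT => nv; apply: H.
  by exists D.
(* A point of [A] shows that the linear system is nonempty, so a [v]-reduced representative [c]
   exists. *)
have [|F0 [RF0 red]] := reduced_exists v (finite_support D).
  by have /suppP[F [RF _]] := AD a0 Aa0; exists F.
pose c z := coeff z D + ord F0 z.
have c0 z : 0 <= c z := RF0.2 z.
have fc : finite_set [set z | c z != 0] := finite_support_ord D RF0.1.
have cv : c v = 0.
  apply/eqP; rewrite eq_le c0 andbT leNgt gtz0_ge1; apply/negP => c1.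
  by apply: nv; apply/suppP; exists F0.
have [U [sU Uv HU]] := special_of_reduced c0 fc cv red.
exists U; split=> //; apply/seteqP; split=> // a [Aa Ua].
have /suppP[F [RF F1]] := AD a Aa.
(* Subtracting [F0] turns a function for [D] into one for [c] with the same resulting divisor. *)
have E z : c z + ord (fun z => F z + - F0 z) z = coeff z D + ord F z.
  rewrite ordD ?ordN; [|exact: RF0.1|exact: RF.1|exact/rationalN/RF0.1].
  by rewrite /c; lia.
have RF' : Rset c (fun z => F z + - F0 z).
  split=> [|z]; first exact/rationalD/rationalN/RF0.1/RF.1.
  by rewrite E; exact: RF.2.
by have := HU _ RF' a Ua; rewrite E => F0E; rewrite F0E in F1.
Qed.

Lemma degE D (L : seq G) : uniq L -> {subset dom D <= L} -> deg D = \sum_(z <- L) coeff z D.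
Proof.
move=> uL sL; rewrite -{1}(freeg_sumE D) raddf_sum /=.
under eq_bigr do rewrite degU.
rewrite [RHS](bigID (fun z => z \in dom D)) /= [X in _ + X]big1 ?addr0; last first.
  by move=> z; exact: coeff_outdom.
rewrite -[RHS]big_filter; apply: perm_big; apply: uniq_perm => [||z].
- exact: uniq_dom.
- exact: filter_uniq.
- by rewrite mem_filter; case: (boolP (z \in dom D)) => // /sL ->.
Qed.

(** Refine until the support consists of vertices, sum the feasibility conditions over all vertices,
    and apply [sum_fl_le0]. *)
Lemma deg_ge0 D F : Rset (cf D) F -> 0 <= deg D.
Proof.
move=> RF; have [H [phi [rphi HP]]] := refinement_at (dom D).
have pI : injective (fun p : vert H => phi (inl p)).
  by move=> p q /(bij_inj (ref_bij rphi)) [].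
pose L := [seq phi (inl p) | p <- enum (vert H)].
rewrite (@degE D L).
- rewrite /L big_map big_enum /=.
  have cV (e : edge H) (z : H) : edge_in e z -> (cf D \o phi) z = 0.
    move=> ez /=; apply: coeff_outdom; apply/negP => /HP[p E].
    by apply: (@edge_in_vert _ _ e p); rewrite (bij_inj (ref_bij rphi) E).
  have RF' : Rset (cf D \o phi) (F \o phi) by exact/Rset_ref.
  have fx := feasible_of_Rset cV RF'.
  have : 0 <= \sum_p ((cf D \o phi) (inl p) + \sum_(d | org d == p) fl (fun p => (F \o phi) (inl p)) d).
    by apply: sumr_ge0 => p _; exact: fx.
  rewrite big_split /= => h; apply: le_trans h _.
  by rewrite gerDl sum_fl_le0.
- by rewrite map_inj_uniq ?enum_uniq.
- by move=> z /HP[p <-]; apply/mapP; exists p; rewrite ?mem_enum.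
Qed.

Lemma effective1 v : effective (<< v >> : divisor).
Proof. by move=> z; rewrite coeffU mul1r; case: eqP. Qed.

Lemma effective_pos E : effective E -> 0 < deg E -> exists2 v, 1 <= coeff v E & effective (E - << v >>).
Proof.
move=> eE dE; have [v vE] : exists v, 1 <= coeff v E.
  apply: contrapT => nv; move: dE; rewrite (degE (uniq_dom E)) // big1 ?ltxx // => z _.
  by apply/eqP; rewrite eq_le eE andbT leNgt gtz0_ge1; apply/negP => h; apply: nv; exists z.
exists v => // z; rewrite coeffB coeffU mul1r; case: eqP => [<-|_]; last by rewrite subr0.
by rewrite subr_ge0.
Qed.

Lemma effective_deg1 E : effective E -> deg E = 1 -> exists v, E = << v >>.
Proof. by move=> eE; apply: deg1pos; apply/fgposP. Qed.

Lemma effective_deg0 E : effective E -> deg E = 0 -> E = 0.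
Proof. by move=> eE; apply: fgpos_eq0P; apply/fgposP. Qed.

Lemma rank_on_ge1 A D : rank_on_ge A D 1 <-> A `<=` supp_linear_system D.
Proof.
split=> [H a Aa|H E eE sE dE].
  apply/supp_sub1; apply: H; [exact: effective1| |by rewrite degU].
  by move=> z; rewrite coeffU mul1r; case: (a =P z) => [<-|].
have [v Ev] := effective_deg1 eE dE; rewrite Ev; apply/supp_sub1/H.
by apply: sE; rewrite Ev coeffU eqxx.
Qed.

(** Split off a point [v] of [E]. Since [v] is in [Lset A], it suffices to treat each [a] in [A] in
    its place, and the induction hypothesis for [D - << a >>] handles the rest of [E]. *)
Lemma rank_on_ge_ext A : Lset A = setT -> forall s D, rank_on_ge A D s -> rank_on_ge setT D s.
Proof.
move=> LA; elim=> [|s IH] D HD E eE _ dE.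
  have E0 := effective_deg0 eE dE; subst E; apply: HD => //.
  by move=> z; rewrite coeff0.
have [|v v1 eE'] := effective_pos eE; first by rewrite dE.
have dE' : deg (E - << v >>) = s%:Z by rewrite degB degU dE; lia.
rewrite (_ : D - E = (D - (E - << v >>)) - << v >>); last first.
  by rewrite opprB addrA addrAC addrK.
apply/supp_sub1; have : Lset A v by rewrite LA.
apply=> a Aa; apply/supp_sub1.
rewrite (_ : _ - _ = (D - << a >>) - (E - << v >>)); last by rewrite addrAC.
apply: (IH (D - << a >>)) => // E'' eE'' sE'' dE''.
rewrite (_ : _ - _ = D - (E'' + << a >>)); last by rewrite opprD addrA addrAC.
apply: HD.
- by move=> z; rewrite coeffD addr_ge0 //; exact: effective1.
- move=> z; rewrite coeffD coeffU mul1r; case: (a =P z) => [<- //|_].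
  by rewrite addr0; exact: sE''.
- by rewrite degD degU dE''; lia.
Qed.

Lemma rank_on_ge_le A D s : A !=set0 -> rank_on_ge A D s.+1 -> rank_on_ge A D s.
Proof.
move=> [a Aa] H E eE sE dE.
have /linear_systemP[F RF] : linear_system (D - (E + << a >>)) !=set0.
  apply: H.
  - by move=> z; rewrite coeffD addr_ge0 //; exact: effective1.
  - move=> z; rewrite coeffD coeffU mul1r; case: (a =P z) => [<- //|_].
    by rewrite addr0; exact: sE.
  - by rewrite degD degU dE; lia.
apply/linear_systemP; exists F; split=> [|z]; first exact: RF.1.
apply: le_trans (RF.2 z) _; rewrite lerD2r !coeffB lerD2l lerN2 coeffD lerDl.
exact: effective1.
Qed.

(** Test with [s] chips at one point of [A]. The bound ensures that a largest [s] exists. *)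
Lemma rank_on_ge_bound A D s : A !=set0 -> rank_on_ge A D s -> s%:Z <= deg D.
Proof.
move=> [a Aa] H.
have /linear_systemP[F /deg_ge0] : linear_system (D - << s%:Z *g a >>) !=set0.
  apply: H; last by rewrite degU.
    by move=> z; rewrite coeffU; case: eqP => _; rewrite ?mulr1 ?mulr0.
  by move=> z; rewrite coeffU; case: (a =P z) => [<- //|_]; rewrite mulr0 eqxx.
by rewrite degB degU subr_ge0.
Qed.

Lemma is_rank_on_exists A D : A !=set0 -> rank_on_ge A D 1 -> exists r, is_rank_on A D r.
Proof.
move=> A0 H1; pose P s := `[< rank_on_ge A D s >].
have exP : exists s, P s by exists 1%N; apply/asboolP.
have bP s : P s -> (s <= `|deg D|)%N by move=> /asboolP/(rank_on_ge_bound A0); lia.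
have [r /asboolP Pr Hr] := ex_maxnP exP bP.
exists r%:Z; right; split=> //.
  have [a Aa] := A0; have [D' [[eD' lD'] _]] := (rank_on_ge1 A D).1 H1 a Aa.
  by exists D'.
move=> s; split=> [|Ps]; last by have := Hr s (introT (asboolP _) Ps).
rewrite lez_nat => /subnK; move: (r - s)%N => k kE; rewrite -kE in Pr.
by elim: k {kE} Pr => // k IH /(rank_on_ge_le A0).
Qed.

Lemma rank_determining_Lset A : A !=set0 -> rank_determining A <-> Lset A = setT.
Proof.
move=> A0; split=> [rA|LA D].
  apply/seteqP; split=> // v _ D AD; have H1 := (rank_on_ge1 A D).2 AD.
  have [r ir] := is_rank_on_exists A0 H1.
  have irA : is_rank_on A D (rank_on A D) by apply: (xgetPex (-1)); exists r.
  have r1 : 1 <= rank_on A D.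
    case: irA => [[D0 _]|[_ _ /(_ 1%N)[_ ->//]]].
    have [a Aa] := A0; have [D' [lD' _]] := AD a Aa.
    by have := lD'; rewrite D0.
  (* If no value were available for [setT], the default would make [rank D] equal to -1; but it
     equals [rank_on A D], which is at least 1. *)
  have irT : is_rank_on setT D (rank D).
    apply: contrapT => nir; have rN : rank D = -1.
      by apply: xgetPN => x rx; apply: nir; apply: (xgetPex (-1)); exists x.
    by rewrite -rA rN in r1.
  case: irT => [[_ rE]|[_ _ /(_ 1%N)[+ _]]]; first by rewrite -rA rE in r1.
  by rewrite rA => /(_ r1)/rank_on_ge1; apply.
have iff s : rank_on_ge setT D s <-> rank_on_ge A D s.
  split; last exact: rank_on_ge_ext.
  by move=> H E eE sE; apply: H.
rewrite /rank /rank_on; congr xget; apply/seteqP; split=> r; rewrite /is_rank_on /=;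
  by case=> [|[h1 h2 h3]]; [left|right; split=> // s; rewrite h3 iff].
Qed.

End Systems.

(** * Transport along the homeomorphism *)

Theorem theorem3p22 (R : realType) (G G' : metric_graph R) (f : G -> G')
    (A : set G) (hf : homeomorphism f) (hA : A !=set0) :
  Lset (f @` A) = f @` Lset A /\
  (rank_determining A <-> rank_determining (f @` A)).
Proof.
have [g [fg gf cf cg]] := hf.
have hfA : f @` A !=set0 by have [a Aa] := hA; exists (f a), a.
have img (S : set G) : f @` S = g @^-1` S.
  by apply/seteqP; split=> z /= => [[x Sx <-]|Sz]; [rewrite fg|exists (g z)].
have LE : Lset (f @` A) = f @` Lset A.
  (* Both inclusions go by contraposition: a special set witnessing that a point is not in one
     [Lset] is carried to the other graph. *)
  rewrite (img (Lset A)); apply/seteqP; split=> z; apply: contraPP.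
    move=> /(not_LsetP _ hA)[U [sU Uz AU]]; apply/(not_LsetP _ hfA).
    have sU' := special_homeo fg gf cf cg sU.
    exists (g @^-1` U); split=> //.
    by rewrite img -preimage_setI AU preimage_set0.
  move=> /(not_LsetP _ hfA)[U [sU Uz AU]]; apply/(not_LsetP _ hA).
  have sU' := special_homeo gf fg cg cf sU.
  exists (f @^-1` U); split=> //.
    by rewrite /= gf.
  apply/seteqP; split=> // a [Aa Ua].
  suff : (f @` A `&` U) (f a) by rewrite AU.
  by split=> //; exists a.
split=> //; rewrite !rank_determining_Lset // LE; split=> [->|E].
  by rewrite img preimage_setT.
apply/seteqP; split=> // z _; have : (f @` Lset A) (f z) by rewrite E.
by rewrite img /= fg.
Qed.
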